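(* Let $\mathfrak g=\mathfrak{gl}(2|2)$, $\mathfrak k=\mathfrak{gl}(1|1)\oplus\mathfrak{gl}(1|1)$, and let $\lambda=(a,1^b)\in\mathscr H(1,1)$ be non-empty ($a\ge1$, $b\ge0$) with $b\neq a-1$. Put $\breve\lambda=a\epsilon^++(-a+2)\epsilon^-+(b-1)\delta^++(-b-1)\delta^-$. Let $v\in\breve W(\breve\lambda)$ be a non-zero vector of weight $(1,1|-1,-1)$. Then $\omega:=\xi_{11}\xi_{22}\otimes v\in K(\breve\lambda)$ is a $\mathfrak k$-spherical vector in $K(\breve\lambda)=V_\lambda$ (i.e. the Kac module $K(\breve\lambda)$ is isomorphic to the irreducible module $V_\lambda$, and $\omega$ is a non-zero $\mathfrak k$-invariant in it).
   Context: Ground field $\mathbb C$. $\mathfrak g=\mathfrak{gl}(2|2)$ with matrix units $E_{a,b}$, indices $1,2$ even and $3,4$ odd. $\mathfrak k$ is the span of the diagonal matrices together with $E_{13},E_{31},E_{24},E_{42}$. $\epsilon^+,\epsilon^-,\delta^+,\delta^-$ are the diagonal coordinate functions at positions $1,2,3,4$ on the diagonal Cartan subalgebra $\mathfrak t$; $(x_1,x_2|x_3,x_4)$ denotes the weight $x_1\epsilon^++x_2\epsilon^-+x_3\delta^++x_4\delta^-$. $\xi_{11}=E_{31}$, $\xi_{22}=E_{42}$. $\mathfrak g=\mathfrak g_{-1}\oplus\mathfrak g_{\bar0}\oplus\mathfrak g_1$, where $\mathfrak g_1$ is spanned by the $E_{ab}$ with $a\le2<b$ and $\mathfrak g_{-1}$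 by those with $b\le2<a$; $\mathfrak g_{\bar0}=\mathfrak{gl}(2)\oplus\mathfrak{gl}(2)$. $\mathscr H(1,1)$ is the set of partitions with $\lambda_2\le1$. $\mathfrak b_\natural^-$ is the Borel subalgebra containing $\mathfrak t$ with simple roots $\epsilon^--\delta^-,\ \delta^--\delta^+,\ \delta^+-\epsilon^+$, and $V_\lambda$ (for $\lambda=(a,1^b)$) is the irreducible $\mathfrak g$-module with $\mathfrak b_\natural^-$-highest weight $a(\epsilon^--\epsilon^+)+b(\delta^--\delta^+)$. $\breve W(\breve\lambda)$ is the irreducible $\mathfrak g_{\bar0}$-module of highest weight $\breve\lambda$ (with respect to the upper triangular Borel subalgebra), extended to $\mathfrak g_{\bar0}\oplus\mathfrak g_1$ by letting $\mathfrak g_1$ act trivially, and the Kac module is $K(\breve\lambda)=\mathrm{Ind}_{\mathfrak g_{\bar0}\oplus\mathfrak g_1}^{\mathfrak g}\breve W(\breve\lambda)\cong\bigwedge(\mathfrak g_{-1})\otimes\breve W(\breve\lambda)$. A non-zero vector $w$ in a $\mathfrak g$-module is $\mathfrak k$-spherical if $X.w=0$ for all $X\in\mathfrak k$. *)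

(* Defs.v *)
From HB Require Import structures.
From mathcomp Require Import all_boot all_order all_algebra.
From mathcomp Require Import reals complex.

Set Implicit Arguments.
Unset Strict Implicit.
Unset Printing Implicit Defensive.

Import Order.TTheory GRing.Theory Num.Theory.
Local Open Scope ring_scope.

Definition x1 : 'I_4 := @Ordinal 4 0 isT.
Definition x2 : 'I_4 := @Ordinal 4 1 isT.
Definition x3 : 'I_4 := @Ordinal 4 2 isT.
Definition x4 : 'I_4 := @Ordinal 4 3 isT.

Definition odd_idx (i : 'I_4) : bool := (2 <= i)%N.

(* Parities are booleans: [false] is even, [true] is odd. *)
Definition mxpart (C : fieldType) (s : bool) (X : 'M[C]_4) : 'M[C]_4 :=
  \matrix_(i, j) (if odd_idx i (+) odd_idx j == s then X i j else 0).

(* The bilinear extension of XY - (-1)^(|X||Y|) YX from homogeneous X, Y. *)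
Definition sbracket (C : fieldType) (X Y : 'M[C]_4) : 'M[C]_4 :=
  \sum_(s : bool) \sum_(t : bool)
    (mxpart s X *m mxpart t Y
     - (-1) ^+ (s && t) *: (mxpart t Y *m mxpart s X)).

Definition mxspan (C : fieldType) (P : rel 'I_4) : {vspace 'M[C]_4} :=
  <<[seq delta_mx ij.1 ij.2
      | ij <- enum [pred ij : ('I_4 * 'I_4)%type | P ij.1 ij.2]]>>%VS.

Definition gl22 (C : fieldType) : {vspace 'M[C]_4} := fullv.

Definition gl22_even (C : fieldType) : {vspace 'M[C]_4} :=
  mxspan C (fun i j => odd_idx i == odd_idx j).

(* g_0 + g_1 *)
Definition gl22_par (C : fieldType) : {vspace 'M[C]_4} :=
  mxspan C (fun i j => odd_idx i ==> odd_idx j).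

Definition kk (C : fieldType) : {vspace 'M[C]_4} :=
  mxspan C (fun i j => (i == j) ||
    ((i, j) \in [:: (x1, x3); (x3, x1); (x2, x4); (x4, x2)])).

(* A Z/2-graded module over a graded subalgebra [h] of gl(2|2).  [sact] is
   total, but only the operators [sact X] with X in [h] are meaningful.  The
   grading is given by the projections [spart false], [spart true] onto the
   even and odd parts. *)
Record smodule (C : fieldType) (h : {vspace 'M[C]_4}) := SModule {
  scar :> lmodType C;
  spart : bool -> scar -> scar;
  sact : 'M[C]_4 -> scar -> scar;
  spart_linear : forall s c v w,
    spart s (c *: v + w) = c *: spart s v + spart s w;
  spart_sum : forall v, spart false v + spart true v = v;
  spart_proj : forall s t v,
    spart s (spart t v) = if s == t then spart t v else 0;
  sact_linear : forall X, X \in h -> forall c v w,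
    sact X (c *: v + w) = c *: sact X v + sact X w;
  sact_linearl : forall X Y, X \in h -> Y \in h -> forall c v,
    sact (c *: X + Y) v = c *: sact X v + sact Y v;
  sact_part : forall s t X v, X \in h -> mxpart s X = X -> spart t v = v ->
    spart (s (+) t) (sact X v) = sact X v;
  sact_bracket : forall s t X Y v, X \in h -> Y \in h ->
    mxpart s X = X -> mxpart t Y = Y ->
    sact (sbracket X Y) v
    = sact X (sact Y v) - (-1) ^+ (s && t) *: sact Y (sact X v)
}.

(* f : M -> N is linear, shifts the parity by p, and commutes with the action
   of h; it is used for h contained in both h1 and h2. *)
Definition smod_hom (C : fieldType) (h : {vspace 'M[C]_4}) (p : bool)
    (h1 h2 : {vspace 'M[C]_4}) (M : smodule h1) (N : smodule h2)
    (f : M -> N) : Prop :=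
  [/\ forall c v w, f (c *: v + w) = c *: f v + f w,
      forall s v, f (spart s v) = spart (s (+) p) (f v)
    & forall X, X \in h -> forall v, f (sact X v) = sact X (f v)].

Definition smod_isom (C : fieldType) (h : {vspace 'M[C]_4})
    (M N : smodule h) : Prop :=
  exists (p : bool) (f : M -> N), smod_hom h p f /\ bijective f.

Definition submodule (C : fieldType) (h : {vspace 'M[C]_4}) (M : smodule h)
    (S : M -> Prop) : Prop :=
  [/\ S 0,
      forall c v w, S v -> S w -> S (c *: v + w),
      forall s v, S v -> S (spart s v)
    & forall X v, X \in h -> S v -> S (sact X v)].

Definition irreducible (C : fieldType) (h : {vspace 'M[C]_4})
    (M : smodule h) : Prop :=
  (exists v : M, v != 0) /\
  forall S : M -> Prop, submodule S ->
    (forall v, S v -> v = 0) \/ (forall v, S v).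

(* Weights are written in the basis of coordinate functions of the diagonal
   Cartan subalgebra: mu is (mu 0 x1, mu 0 x2 | mu 0 x3, mu 0 x4). *)
Definition epsp (C : fieldType) : 'rV[C]_4 := delta_mx 0 x1.
Definition epsm (C : fieldType) : 'rV[C]_4 := delta_mx 0 x2.
Definition delp (C : fieldType) : 'rV[C]_4 := delta_mx 0 x3.
Definition delm (C : fieldType) : 'rV[C]_4 := delta_mx 0 x4.

Definition weight_vector (C : fieldType) (h : {vspace 'M[C]_4})
    (M : smodule h) (mu : 'rV[C]_4) (v : M) : Prop :=
  forall d : 'rV[C]_4, sact (diag_mx d) v = (\sum_i d 0 i * mu 0 i) *: v.

(* An enumeration [i1; i2; i3; i4] of the four indices encodes the Borel
   subalgebra spanned by the diagonal matrices and the E_(i,j) with i before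
   j; its simple roots are the differences of the coordinate functions at i1
   and i2, at i2 and i3, and at i3 and i4.  For a subalgebra h spanned by
   matrix units it is intersected with h. *)
Definition highest_weight_vector (C : fieldType) (s : seq 'I_4)
    (h : {vspace 'M[C]_4}) (M : smodule h) (mu : 'rV[C]_4) (v : M) : Prop :=
  [/\ v != 0, weight_vector mu v
    & forall i j : 'I_4, (index i s < index j s)%N ->
        delta_mx i j \in h -> sact (delta_mx i j) v = 0].

Definition irreducible_hw (C : fieldType) (s : seq 'I_4)
    (h : {vspace 'M[C]_4}) (mu : 'rV[C]_4) (M : smodule h) : Prop :=
  irreducible M /\ exists v : M, highest_weight_vector s mu v.

Definition upper_order : seq 'I_4 := [:: x1; x2; x3; x4].

(* Simple roots epsm - delm, delm - delp, delp - epsp. *)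
Definition natural_order : seq 'I_4 := [:: x2; x4; x3; x1].

Lemma mem_mxspan (C : fieldType) (P : rel 'I_4) (X : 'M[C]_4) :
  reflect (forall i j, ~~ P i j -> X i j = 0) (X \in mxspan C P).
Proof.
apply: (iffP idP) => [Xin i j Pij|X0].
  rewrite (coord_span (X := in_tuple _) Xin) summxE big1 // => k _; rewrite mxE.
  set t := (_`_k).
  have : t \in [seq delta_mx ij.1 ij.2 : 'M[C]_4
                | ij <- enum [pred ij : ('I_4 * 'I_4)%type | P ij.1 ij.2]].
    by apply: mem_nth; case: (k).
  case/mapP=> -[a b]; rewrite mem_enum inE /= => Pab ->.
  rewrite mxE; case: eqP => [ia|_]; last by rewrite mulr0.
  case: eqP => [jb|_]; last by rewrite mulr0.
  by move: Pij; rewrite ia jb Pab.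
rewrite (matrix_sum_delta X); apply: memv_suml => i _; apply: memv_suml => j _.
have [Pij|nPij] := boolP (P i j); last by rewrite X0 // scale0r mem0v.
apply/memvZ/memv_span/mapP; exists (i, j) => //.
by rewrite mem_enum inE.
Qed.

Section Inflation.
Variables (C : fieldType) (W : smodule (gl22_even C)).

Let act (X : 'M[C]_4) (w : W) : W := sact (mxpart false X) w.

Lemma mxpart_proj s t (X : 'M[C]_4) :
  mxpart s (mxpart t X) = if s == t then mxpart t X else 0.
Proof.
apply/matrixP=> i j; rewrite (fun_if (fun A : 'M[C]_4 => A i j)) !mxE.
by case: (odd_idx i (+) odd_idx j); case: s; case: t.
Qed.

Lemma mxpart_even (X : 'M[C]_4) : mxpart false X \in gl22_even C.
Proof.
apply/mem_mxspan=> i j; rewrite mxE.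
by case: (odd_idx i); case: (odd_idx j).
Qed.

Lemma mxpart_linear s c (X Y : 'M[C]_4) :
  mxpart s (c *: X + Y) = c *: mxpart s X + mxpart s Y.
Proof.
by apply/matrixP=> i j; rewrite !mxE; case: ifP; rewrite ?mulr0 ?addr0.
Qed.

Lemma sact0l (w : W) : sact 0 w = 0.
Proof.
have h0 : (0 : 'M[C]_4) \in gl22_even C by rewrite mem0v.
have := sact_linearl h0 h0 (-1) w.
by rewrite scaler0 addr0 scaleN1r addNr.
Qed.

Lemma sact0r X : X \in gl22_even C -> sact X (0 : W) = 0.
Proof.
move=> hX; have := sact_linear hX (-1) (0 : W) 0.
by rewrite scaler0 addr0 scaleN1r addNr.
Qed.

Lemma mxpart_sbracket (X Y : 'M[C]_4) :
  X \in gl22_par C -> Y \in gl22_par C ->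
  mxpart false (sbracket X Y) = sbracket (mxpart false X) (mxpart false Y).
Proof.
have mx0 s : mxpart s (0 : 'M[C]_4) = 0.
  by apply/matrixP=> i j; rewrite !mxE; case: ifP.
have mul_part s t (A B : 'M[C]_4) :
    mxpart (s (+) t) (mxpart s A *m mxpart t B) = mxpart s A *m mxpart t B.
  apply/matrixP=> i j; rewrite mxE; case: ifP => // /negbT nst.
  rewrite mxE big1 // => k _; rewrite !mxE.
  case: eqP => [es|_]; last by rewrite mul0r.
  case: eqP => [et|_]; last by rewrite mulr0.
  by case/negP: nst; rewrite -es -et addbA addbK.
have mul_odd (A B : 'M[C]_4) : A \in gl22_par C -> B \in gl22_par C ->
    mxpart true A *m mxpart true B = 0.
  move=> /mem_mxspan hA /mem_mxspan hB; apply/matrixP=> i j; rewrite !mxE.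
  rewrite big1 // => k _; rewrite !mxE.
  case: eqP => [es|_]; last by rewrite mul0r.
  case: eqP => [et|_]; last by rewrite mulr0.
  have [ok|nk] := boolP (odd_idx k).
    rewrite (hB k j) ?mulr0 //; move: et; rewrite ok /=.
    by case: (odd_idx j).
  rewrite (hA i k) ?mul0r //; move: es; rewrite (negbTE nk) addbF => ->.
  by [].
have partE s t u (A B : 'M[C]_4) :
    mxpart u (mxpart s A *m mxpart t B)
    = if u == s (+) t then mxpart s A *m mxpart t B else 0.
  rewrite -[in LHS](mul_part s t) mxpart_proj mul_part.
  by case: eqP.
have partD u (A B : 'M[C]_4) : mxpart u (A + B) = mxpart u A + mxpart u B.
  by have := mxpart_linear u 1 A B; rewrite !scale1r.
have partN u (A : 'M[C]_4) : mxpart u (- A) = - mxpart u A.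
  by have := mxpart_linear u (-1) A 0; rewrite !scaleN1r mx0 !addr0.
move=> hX hY; rewrite /sbracket !big_bool /=.
rewrite !mxpart_proj /= !mul0mx !mulmx0 !expr0 !expr1 !scale1r !scaleN1r.
rewrite !oppr0 !addr0 !add0r !partD !partN !partE /=.
by rewrite (mul_odd X Y) // (mul_odd Y X) // !oppr0 !addr0 !add0r.
Qed.

Lemma inflate_part s t X (w : W) : X \in gl22_par C -> mxpart s X = X ->
  spart t w = w -> spart (s (+) t) (act X w) = act X w.
Proof.
move=> _ sX tw; rewrite /act -sX mxpart_proj.
have [<-|ns] := eqVneq false s.
  by apply: sact_part; rewrite ?mxpart_even // mxpart_proj.
rewrite sact0l; have := spart_linear (s (+) t) (-1) (0 : W) 0.
by rewrite scaler0 addr0 scaleN1r addNr.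
Qed.

Lemma inflate_bracket s t X Y (w : W) :
  X \in gl22_par C -> Y \in gl22_par C -> mxpart s X = X -> mxpart t Y = Y ->
  act (sbracket X Y) w
  = act X (act Y w) - (-1) ^+ (s && t) *: act Y (act X w).
Proof.
move=> hX hY sX tY; rewrite /act mxpart_sbracket //.
rewrite (@sact_bracket _ _ _ false false) ?mxpart_even ?mxpart_proj //.
case: s t sX tY => [] [] // sX tY; rewrite /= ?expr0 //.
by rewrite -sX mxpart_proj /= !sact0l ?sact0r ?mxpart_even ?scaler0.
Qed.

(* W extended to g_0 + g_1 by letting g_1 act trivially. *)
Definition inflate : smodule (gl22_par C).
Proof.
refine (@SModule C (gl22_par C) (scar W) (@spart _ _ W) act
  (@spart_linear _ _ W) (@spart_sum _ _ W) (@spart_proj _ _ W) _ _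
  inflate_part inflate_bracket).
- by move=> X _ c v w; apply: sact_linear; apply: mxpart_even.
- move=> X Y _ _ c v; rewrite /act mxpart_linear.
  by apply: sact_linearl; apply: mxpart_even.
Defined.

End Inflation.

(* (K, i) is the module induced from the h-module W, with i : W -> K the
   canonical map w |-> 1 (x) w: Hom_h(W, N) = Hom_g(K, N) naturally in the
   g-module N. *)
Definition is_induced (C : fieldType) (h : {vspace 'M[C]_4}) (W : smodule h)
    (K : smodule (gl22 C)) (i : W -> K) : Prop :=
  smod_hom h false i /\
  forall (N : smodule (gl22 C)) (f : W -> N), smod_hom h false f ->
    exists F : K -> N,
      [/\ smod_hom (gl22 C) false F,
          forall w, F (i w) = f w
        & forall G : K -> N, smod_hom (gl22 C) false G ->
            (forall w, G (i w) = f w) -> G =1 F].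

Definition is_Kac (C : fieldType) (W : smodule (gl22_even C))
    (K : smodule (gl22 C)) (i : W -> K) : Prop :=
  @is_induced C (gl22_par C) (inflate W) K i.

Definition k_spherical (C : fieldType) (M : smodule (gl22 C)) (w : M) : Prop :=
  w != 0 /\ forall X, X \in kk C -> sact X w = 0.

Definition hook11 (la : seq nat) : bool :=
  [&& sorted geq la, 0%N \notin la & (nth 0 la 1 <= 1)%N].

(* M is V_lambda for lambda = (a, 1^b). *)
Definition is_V (C : fieldType) (a b : nat) (M : smodule (gl22 C)) : Prop :=
  irreducible_hw natural_order
    (a%:R *: (epsm C - epsp C) + b%:R *: (delm C - delp C)) M.

Definition breve_weight (C : fieldType) (a b : nat) : 'rV[C]_4 :=
  a%:R *: epsp C + (- a%:R + 2) *: epsm C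
  + (b%:R - 1) *: delp C + (- b%:R - 1) *: delm C.

Definition xi11 (C : fieldType) : 'M[C]_4 := delta_mx x3 x1.
Definition xi22 (C : fieldType) : 'M[C]_4 := delta_mx x4 x2.

(* Main.v *)
Require Import Defs.
From mathcomp Require Import all_boot all_order all_algebra.
From mathcomp Require Import reals complex boolp ring.
Import GRing.Theory Num.Theory.
Local Open Scope ring_scope.

(** The theorem says that a Kac module is typical, that it has the highest weight
   of [V_lambda] for the other Borel subalgebra, and that an explicit vector is
   invariant.

   The Kac module is known only by its universal property, so it is first
   identified with the exterior algebra of the lowering part tensored with [W]
   ([Kac_structure]).  Commuting a matrix unit through an ordered monomial in
   [E31, E32, E41, E42] down to [W] gives a finite table [kac_act].  The table
   is forced in any module that receives a map from [W] ([kac_actP]); that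
   conversely it defines a module on sixteen copies of [W] is a finite list of
   identities between words in the even matrix units, verified by computation
   ([bracket_defect0]).  The universal property does the rest.

   Irreducibility ([Kac_irreducible]) is the classical argument: a non-zero
   submodule reaches the top exterior power, hence the top monomial applied to a
   highest weight vector of [W], and applying the raising elements multiplies by
   the product of the four numbers [(weight + rho, eps_i - del_j)].  Here these
   are [a + b] and [a - b - 1], up to sign and each occurring twice, so the
   hypothesis that [b] differs from [a - 1] is exactly typicality.

   To recognize [V_lambda], odd reflections are applied to a lowest weight vector
   of [W], whose existence rests on the finite [sl(2)]-strings of the dominant
   weight [breve_weight] ([lowest_weight_vector]); the result is a highest weight
   vector [E31 E41 w] of the required weight ([Kac_breve_natural]).  Two
   irreducible modules with the same highest weight are isomorphic
   ([irreducible_hw_isom]): in their direct sum a pair of highest weight vectors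
   generates a submodule in which the highest weight has multiplicity one, and
   this submodule is the graph of an isomorphism.

   Finally, the invariance of [E31 E42 v] is read off the table, and this vector
   is non-zero because monomials are injective on [W]. *)

Set Implicit Arguments.
Unset Strict Implicit.
Unset Printing Implicit Defensive.

(** * Modules over subalgebras of gl(2|2) and matrix units *)

Section LinearFunctions.
Variables (C : fieldType) (U V : lmodType C) (A : U -> V).
Hypothesis Alin : forall c x y, A (c *: x + y) = c *: A x + A y.

Lemma lin_fun0 : A 0 = 0.
Proof. by have := Alin (-1) 0 0; rewrite scaler0 addr0 scaleN1r addNr. Qed.

Lemma lin_funD x y : A (x + y) = A x + A y.
Proof. by have := Alin 1 x y; rewrite !scale1r. Qed.

Lemma lin_funZ c x : A (c *: x) = c *: A x.
Proof. by have := Alin c x 0; rewrite lin_fun0 !addr0. Qed.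

Lemma lin_fun_sum (I : Type) (r : seq I) (P : pred I) (F : I -> U) :
  A (\sum_(k <- r | P k) F k) = \sum_(k <- r | P k) A (F k).
Proof. exact: (big_morph _ lin_funD lin_fun0). Qed.

End LinearFunctions.

Section SModuleTheory.
Variables (C : fieldType) (h : {vspace 'M[C]_4}) (M : smodule h).
Implicit Types (X Y : 'M[C]_4) (x y : M).

Lemma spart0 s : spart s (0 : M) = 0.
Proof. exact/lin_fun0/spart_linear. Qed.

Lemma spartZ s c x : spart s (c *: x) = c *: spart s x.
Proof. exact/lin_funZ/spart_linear. Qed.

Lemma spartD s x y : spart s (x + y) = spart s x + spart s y.
Proof. exact/lin_funD/spart_linear. Qed.

Lemma sactr0 X : X \in h -> sact X (0 : M) = 0.
Proof. by move=> hX; apply/lin_fun0/(sact_linear hX). Qed.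

Lemma sactrZ X c x : X \in h -> sact X (c *: x) = c *: sact X x.
Proof. by move=> hX; apply/lin_funZ/(sact_linear hX). Qed.

Lemma sactrD X x y : X \in h -> sact X (x + y) = sact X x + sact X y.
Proof. by move=> hX; apply/lin_funD/(sact_linear hX). Qed.

Lemma sactl0 x : sact 0 x = 0.
Proof.
have h0 : 0 \in h by rewrite mem0v.
by have := sact_linearl h0 h0 (-1) x; rewrite scaler0 addr0 scaleN1r addNr.
Qed.

Lemma sactlZ X c x : X \in h -> sact (c *: X) x = c *: sact X x.
Proof.
move=> hX; have := sact_linearl hX (mem0v h) c x.
by rewrite sactl0 !addr0.
Qed.

Lemma sactlD X Y x : X \in h -> Y \in h -> sact (X + Y) x = sact X x + sact Y x.
Proof. by move=> hX hY; have := sact_linearl hX hY 1 x; rewrite !scale1r. Qed.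

Lemma sactl_sum (I : Type) (r : seq I) (P : pred I) (F : I -> 'M[C]_4) x :
  (forall k, P k -> F k \in h) ->
  sact (\sum_(k <- r | P k) F k) x = \sum_(k <- r | P k) sact (F k) x.
Proof.
move=> hF; suff [] : \sum_(k <- r | P k) F k \in h /\
  sact (\sum_(k <- r | P k) F k) x = \sum_(k <- r | P k) sact (F k) x by [].
elim/big_rec2: _ => [|k y1 y2 Pk [hy2 <-]]; first by rewrite mem0v sactl0.
by rewrite memvD ?sactlD ?hF.
Qed.

(** The grading axiom of a module, freed from the assumption that the vector is
   homogeneous. *)
Lemma spart_sact s t X x : X \in h -> mxpart s X = X ->
  spart (s (+) t) (sact X x) = sact X (spart t x).
Proof.
move=> hX sX; rewrite -[in LHS](spart_sum x) sactrD // spartD.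
have part u : spart (s (+) u) (sact X (spart u x)) = sact X (spart u x).
  by rewrite sact_part // spart_proj eqxx.
have part0 u : spart (~~ (s (+) u)) (sact X (spart u x)) = 0.
  by rewrite -part spart_proj; case: (s (+) u).
case: t; first by rewrite part; move: (part0 false); rewrite -addbN /= => ->; rewrite add0r.
by rewrite part; move: (part0 true); rewrite -addbN /= => ->; rewrite addr0.
Qed.

End SModuleTheory.

Section MatrixUnits.
Variable C : fieldType.
Local Notation E i j := (delta_mx i j : 'M[C]_4).

Lemma mxpart_delta i j : mxpart (odd_idx i (+) odd_idx j) (E i j) = E i j.
Proof.
apply/matrixP=> k l; rewrite !mxE; case: (k =P i) => [->|_] /=; last by case: ifP.
by case: (l =P j) => [->|_] /=; rewrite ?eqxx //; case: ifP.
Qed.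

Lemma mxpart_even_delta i j :
  mxpart false (E i j) = if odd_idx i (+) odd_idx j then 0 else E i j.
Proof.
by rewrite -[in LHS](mxpart_delta i j) mxpart_proj mxpart_delta; case: (_ (+) _).
Qed.

Lemma sbracket_homog s t (X Y : 'M[C]_4) : mxpart s X = X -> mxpart t Y = Y ->
  sbracket X Y = X *m Y - (-1) ^+ (s && t) *: (Y *m X).
Proof.
move=> sX tY; rewrite /sbracket -sX -tY !big_bool /= !mxpart_proj.
by case: s {sX}; case: t {tY};
  rewrite /= ?mul0mx ?mulmx0 ?scaler0 ?subr0 ?add0r ?addr0.
Qed.

Lemma sbracket_delta i j k l :
  sbracket (E i j) (E k l) = E i l *+ (j == k)
    - (-1) ^+ ((odd_idx i (+) odd_idx j) && (odd_idx k (+) odd_idx l))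
      *: (E k j *+ (l == i)).
Proof.
rewrite (sbracket_homog (mxpart_delta i j) (mxpart_delta k l)).
by rewrite !mul_delta_mx_cond.
Qed.

(** Covers both the subalgebras given as an [mxspan] and the whole algebra,
   which is given as [fullv]. *)
Definition unit_spanned (h : {vspace 'M[C]_4}) : Prop :=
  forall X : 'M[C]_4, X \in h -> forall i j, X i j != 0 -> E i j \in h.

Lemma unit_spanned_gl22 : unit_spanned (gl22 C).
Proof. by move=> X _ i j _; rewrite memvf. Qed.

Lemma delta_mxspan (P : rel 'I_4) i j : P i j -> E i j \in mxspan C P.
Proof.
move=> Pij; apply/mem_mxspan => k l; apply: contraNeq.
by rewrite mxE; case: (k =P i) => [->|_]; case: (l =P j) => [->|_]; rewrite ?eqxx.
Qed.

Lemma unit_spanned_mxspan (P : rel 'I_4) : unit_spanned (mxspan C P).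
Proof.
move=> X /mem_mxspan hX i j nz; apply: delta_mxspan.
by apply: contraNT nz => nP; rewrite hX.
Qed.

Lemma sact_delta_sum (h : {vspace 'M[C]_4}) (M : smodule h) X (x : M) :
  unit_spanned h -> X \in h ->
  sact X x = \sum_i \sum_(j | X i j != 0) X i j *: sact (E i j) x.
Proof.
move=> hu hX.
have XE : X = \sum_i \sum_(j | X i j != 0) X i j *: E i j.
  rewrite [LHS]matrix_sum_delta; apply: eq_bigr => i _.
  rewrite [LHS](bigID (fun j => X i j != 0)) /= [X in _ + X]big1 ?addr0 //.
  by move=> j /negPn/eqP ->; rewrite scale0r.
have hE i j : X i j != 0 -> E i j \in h by apply: hu.
rewrite {1}XE sactl_sum => [|i _]; last first.
  by apply: memv_suml => j nz; rewrite memvZ ?hE.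
apply: eq_bigr => i _; rewrite sactl_sum => [|j nz]; last by rewrite memvZ ?hE.
by apply: eq_bigr => j nz; rewrite sactlZ ?hE.
Qed.

End MatrixUnits.

(** * Weights, and the uniqueness of irreducible highest weight modules *)

Lemma mxpart_diag (C : fieldType) (d : 'rV[C]_4) :
  mxpart false (diag_mx d) = diag_mx d.
Proof.
apply/matrixP=> k l; rewrite !mxE; case: (k =P l) => [->|_]; last by case: ifP.
by rewrite addbb.
Qed.

Section WeightTheory.
Variables (C : fieldType) (h : {vspace 'M[C]_4}) (M : smodule h).
Hypothesis (ht : forall d, diag_mx d \in h).
Local Notation E i j := (delta_mx i j : 'M[C]_4).

Lemma delta_diag i : E i i = diag_mx (delta_mx 0 i).
Proof.
apply/matrixP=> k l; rewrite !mxE eqxx /=; have [->|nkl] := eqVneq k l.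
  by case: (l == i).
by case: (k =P i) nkl => [->|] //; rewrite eq_sym => /negbTE->.
Qed.

Lemma sact_diag_delta d i j (x : M) : E i j \in h ->
  sact (diag_mx d) (sact (E i j) x)
  = sact (E i j) (sact (diag_mx d) x) + (d 0 i - d 0 j) *: sact (E i j) x.
Proof.
move=> hE.
have sd := mxpart_diag d.
have := sact_bracket x (ht d) hE sd (mxpart_delta C i j).
rewrite (sbracket_homog sd (mxpart_delta C i j)) /= scale1r expr0 scale1r.
have -> : diag_mx d *m E i j - E i j *m diag_mx d = (d 0 i - d 0 j) *: E i j.
  apply/matrixP=> k l; rewrite mul_diag_mx mul_mx_diag !mxE.
  case: (k =P i) => [->|_]; case: (l =P j) => [->|_];
    by rewrite /= ?mulr0 ?mul0r ?subr0 // mulr1 mul1r mulr1.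
by rewrite sactlZ // => ->; rewrite addrC subrK.
Qed.

Lemma weight_vector_delta mu i j (x : M) : E i j \in h -> weight_vector mu x ->
  weight_vector (mu + delta_mx 0 i - delta_mx 0 j) (sact (E i j) x).
Proof.
move=> hE wx d; rewrite sact_diag_delta // wx sactrZ // -scalerDl; congr (_ *: _).
have sumd k : \sum_l d 0 l * ((0 == 0 :> 'I_1) && (l == k))%:R = d 0 k :> C.
  rewrite (bigD1 k) //= eqxx mulr1 big1 ?addr0 // => l nlk.
  by rewrite (negbTE nlk) mulr0.
under [in RHS]eq_bigr do rewrite !mxE mulrBr mulrDr.
by rewrite sumrB big_split /= !sumd addrA.
Qed.

Lemma weight_vector_unit (mu : 'rV[C]_4) i (x : M) : weight_vector mu x ->
  sact (E i i) x = mu 0 i *: x.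
Proof.
move=> wx; rewrite delta_diag wx (bigD1 i) //= big1 => [|l nl].
  by rewrite mxE !eqxx mul1r addr0.
by rewrite mxE (negbTE nl) andbF mul0r.
Qed.

(** Submodules are graded, whereas highest weight vectors need not be
   homogeneous; a non-zero homogeneous component is again one. *)
Lemma highest_weight_homog s mu (v : M) : highest_weight_vector s mu v ->
  exists t (u : M), spart t u = u /\ highest_weight_vector s mu u.
Proof.
case=> v0 wv kv.
have [t nz] : exists t, spart t v != 0.
  have [e|nz] := eqVneq (spart false v) 0; last by exists false.
  by exists true; apply: contraNneq v0 => e1; rewrite -(spart_sum v) e e1 addr0.
exists t, (spart t v); split; first by rewrite spart_proj eqxx.
split=> // [d|i j lt hE].
  by rewrite -(spart_sact t v (ht d) (mxpart_diag d)) wv spartZ.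
by rewrite -(spart_sact t v hE (mxpart_delta C i j)) kv // spart0.
Qed.

End WeightTheory.

Section LowerSums.
Variables (C : numFieldType) (V : lmodType C) (D : V -> V).
Hypothesis (Dlin : forall c x y, D (c *: x + y) = c *: D x + D y).
Implicit Types (e : C) (x y u : V).

Inductive lower_sum e : V -> Prop :=
| LowerSum0 : lower_sum e 0
| LowerSumS u x n : lower_sum e u -> D x = (e - n.+1%:R) *: x ->
    lower_sum e (u + x).

Lemma lower_sumD e u x : lower_sum e u -> lower_sum e x -> lower_sum e (u + x).
Proof.
move=> lu; elim=> [|y z n _ IH Dz]; first by rewrite addr0.
by rewrite addrA; apply: LowerSumS Dz.
Qed.

Lemma lower_sum_eigen e x n : D x = (e - n.+1%:R) *: x -> lower_sum e x.
Proof. by move=> Dx; rewrite -[x]add0r; apply: LowerSumS Dx; apply: LowerSum0. Qed.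

Lemma lower_sumZ e c u : lower_sum e u -> lower_sum e (c *: u).
Proof.
elim=> [|y z n _ IH Dz]; first by rewrite scaler0; apply: LowerSum0.
rewrite scalerDr; apply: (LowerSumS (n := n) IH).
by rewrite (lin_funZ Dlin) Dz scalerA mulrC -scalerA.
Qed.

Lemma lower_sumW e k u : lower_sum e u -> lower_sum (e + k%:R) u.
Proof.
elim=> [|y z n _ IH Dz]; first exact: LowerSum0.
apply: (LowerSumS (n := (n + k)%N)) => //; rewrite Dz; congr (_ *: _).
by rewrite -addSn addnC natrD addrKA.
Qed.

Lemma lower_sum_shift e m (f : V -> V) u :
  (forall c x y, f (c *: x + y) = c *: f x + f y) ->
  (forall x, D (f x) = f (D x) - m%:R *: f x) ->
  lower_sum e u -> lower_sum e (f u).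
Proof.
move=> flin Df.
elim=> [|y z n _ IH Dz]; first by rewrite (lin_fun0 flin); apply: LowerSum0.
rewrite (lin_funD flin); apply: (LowerSumS (n := (n + m)%N)) => //.
by rewrite Df Dz (lin_funZ flin) -scalerBl -addSn natrD opprD addrA.
Qed.

(** Eigenvectors for distinct eigenvalues are independent: a product of factors
   [D - (e - n.+1)] annihilates the sum, but acts on an eigenvector of
   eigenvalue [e] by a non-zero scalar. *)
Lemma lower_sum_eq0 e u : lower_sum e u -> D u = e *: u -> u = 0.
Proof.
pose A n x := D x - (e - n.+1%:R) *: x.
pose Q ks x := foldl (fun y n => A n y) x ks.
have AD n x y : A n (x + y) = A n x + A n y.
  by rewrite /A (lin_funD Dlin) scalerDr opprD addrACA.
have QD ks x y : Q ks (x + y) = Q ks x + Q ks y.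
  by elim: ks x y => //= n ks IH x y; rewrite AD IH.
have Q0 ks : Q ks 0 = 0.
  by apply: (addrI (Q ks 0)); rewrite -QD !addr0.
have AA n m x : A n (A m x) = A m (A n x).
  rewrite /A -!scaleNr !(lin_funD Dlin) !(lin_funZ Dlin) !scalerDr !scalerA -!addrA; congr (_ + _).
  by rewrite addrCA mulrC.
have QA ks n x : Q ks (A n x) = A n (Q ks x).
  by elim: ks x => //= m ks IH x; rewrite AA IH.
have kill x : lower_sum e x -> exists ks, Q ks x = 0.
  elim=> [|y z n _ [ks IH] Dz]; first by exists [::].
  exists (n :: ks) => /=; rewrite -/(Q _ _) QA QD IH add0r -QA.
  by rewrite {1}/A Dz subrr Q0.
move=> /kill[ks] Qu Du; move: Qu.
have step n : A n u = n.+1%:R *: u by rewrite /A Du scalerBl opprB addrCA subrr addr0.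
have QZ ls c x : Q ls (c *: x) = c *: Q ls x.
  elim: ls x => //= n ls IH x; rewrite -IH; congr (Q ls _).
  by rewrite /A (lin_funZ Dlin) scalerBr !scalerA mulrC.
elim: ks => //= n ks IH; rewrite -/(Q _ _) step QZ => /eqP.
by rewrite scaler_eq0 pnatr_eq0 /= => /eqP.
Qed.

End LowerSums.

Section HighestWeightRelation.
Variables (C : numFieldType) (h : {vspace 'M[C]_4}).
Hypotheses (ht : forall d, diag_mx d \in h) (hu : unit_spanned h).
Hypothesis (hbr : forall X Y, X \in h -> Y \in h -> sbracket X Y \in h).
Local Notation E i j := (delta_mx i j : 'M[C]_4).
Variables (M N : smodule h) (s : seq 'I_4).

(** The span of what lowering matrix units make of [(v, w)] in the direct sum
   of [M] and [N].  As a relation between [M] and [N] it is the candidate for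
   the graph of an isomorphism, and the direct sum itself need not be built. *)
Inductive hw_rel (v : M) (w : N) : M -> N -> Prop :=
| HwBase : hw_rel v w v w
| HwLin c x y x' y' : hw_rel v w x y -> hw_rel v w x' y' ->
    hw_rel v w (c *: x + x') (c *: y + y')
| HwLow i j x y : (index j s < index i s)%N -> E i j \in h ->
    hw_rel v w x y -> hw_rel v w (sact (E i j) x) (sact (E i j) y).

Variables (v : M) (w : N) (mu : 'rV[C]_4) (t p : bool).
Hypotheses (hv : highest_weight_vector s mu v) (hw : highest_weight_vector s mu w).
Hypotheses (tv : spart t v = v) (tw : spart (t (+) p) w = w).
Local Notation rel := (hw_rel v w).

Lemma hw_rel0 : rel 0 0.
Proof. by have := HwLin (-1) (HwBase v w) (HwBase v w); rewrite !scaleN1r !addNr. Qed.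

Lemma hw_relZ c x y : rel x y -> rel (c *: x) (c *: y).
Proof. by move=> r; have := HwLin c r hw_rel0; rewrite !addr0. Qed.

Lemma hw_relD x y x' y' : rel x y -> rel x' y' -> rel (x + x') (y + y').
Proof. by move=> r r'; have := HwLin 1 r r'; rewrite !scale1r. Qed.

Lemma hw_rel_units x y :
  (forall i j, E i j \in h -> rel (sact (E i j) x) (sact (E i j) y)) ->
  forall X, X \in h -> rel (sact X x) (sact X y).
Proof.
move=> r X hX; rewrite !sact_delta_sum //.
apply: (big_ind2 rel) => [||i _]; [exact: hw_rel0|exact: hw_relD|].
apply: (big_ind2 rel) => [||j nz]; [exact: hw_rel0|exact: hw_relD|].
by apply/hw_relZ/r/(hu hX).
Qed.

Hypothesis (sfull : forall i, i \in s).

(** Lowering units alone generate, yet the result is stable under all of [h]: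
   moving [E k l] past a lowering unit [f] leaves [f (E k l x)] and
   [[E k l, f] x], and both are covered by the induction hypothesis for [x]
   because it speaks of every element of [h] at once.  This replaces the
   triangular decomposition of an enveloping algebra. *)
Lemma hw_rel_sact x y : rel x y -> forall X, X \in h -> rel (sact X x) (sact X y).
Proof.
elim=> {x y} [|c x y x' y' _ IH _ IH' X hX|i j x y lt hE r IH];
  last 1 first.
- apply: hw_rel_units => k l hkl.
  have comm (Q : smodule h) (z : Q) : sact (E k l) (sact (E i j) z)
      = (-1) ^+ ((odd_idx k (+) odd_idx l) && (odd_idx i (+) odd_idx j))
        *: sact (E i j) (sact (E k l) z) + sact (sbracket (E k l) (E i j)) z.
    by rewrite (sact_bracket z hkl hE (mxpart_delta C k l) (mxpart_delta C i j)) addrC subrK.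
  rewrite !comm; apply: HwLin; last by apply: IH; apply: hbr.
  by apply: HwLow lt hE _; apply: IH.
- apply: hw_rel_units => i j hE.
  case: hv hw => v0 wv kv [w0 ww kw].
  case: (ltngtP (index i s) (index j s)) => [lt|gt|eq_ij].
  + by rewrite kv ?kw //; apply: hw_rel0.
  + by apply: HwLow gt hE _; apply: HwBase.
  + have <- : i = j by move/index_inj: eq_ij => /(_ i); apply.
    rewrite (weight_vector_unit i wv) (weight_vector_unit i ww).
    by apply/hw_relZ/HwBase.
by rewrite !sact_linear //; apply: HwLin; [apply: IH|apply: IH'].
Qed.

Lemma hw_rel_spart x y : rel x y -> forall u, rel (spart u x) (spart (u (+) p) y).
Proof.
elim=> {x y} [u|c x y x' y' _ IH _ IH' u|i j x y lt hE r IH u].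
- have [->|ntu] := eqVneq u t; first by rewrite tv tw; apply: HwBase.
  have -> : spart u v = 0 by rewrite -tv spart_proj (negbTE ntu).
  have -> : spart (u (+) p) w = 0.
    by rewrite -tw spart_proj (inj_eq (can_inj (addbK p))) (negbTE ntu).
  exact: hw_rel0.
- by rewrite !spart_linear; apply: HwLin.
set e := odd_idx i (+) odd_idx j.
have -> : u = e (+) (e (+) u) by rewrite addKb.
rewrite -addbA !(spart_sact _ _ hE (mxpart_delta C i j)).
exact: HwLow.
Qed.

(** A single diagonal matrix tells the highest weight from all lower ones: a
   lowering matrix unit decreases its eigenvalue by a positive integer. *)
Definition height_mx : 'M[C]_4 := diag_mx (\row_i - (index i s)%:R).
Definition height_of (nu : 'rV[C]_4) : C := \sum_i - (index i s)%:R * nu 0 i.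

Lemma weight_height (Q : smodule h) nu (x : Q) : weight_vector nu x ->
  sact height_mx x = height_of nu *: x.
Proof. by move=> ->; congr (_ *: _); apply: eq_bigr => i _; rewrite mxE. Qed.

Lemma height_low (Q : smodule h) i j (x : Q) :
  (index j s < index i s)%N -> E i j \in h ->
  sact height_mx (sact (E i j) x)
  = sact (E i j) (sact height_mx x) - (index i s - index j s)%:R *: sact (E i j) x.
Proof.
move=> lt hE; rewrite {1}/height_mx (sact_diag_delta ht _ _ hE); congr (_ + _).
by rewrite !mxE -scaleNr (natrB _ (ltnW lt)) opprB opprK addrC.
Qed.

Local Notation low Q := (lower_sum (sact height_mx : Q -> Q) (height_of mu)).

Lemma hw_rel_lower x y : rel x y ->
  exists c, low M (x - c *: v) /\ low N (y - c *: w).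
Proof.
have hD : height_mx \in h by apply: ht.
have Hlin (Q : smodule h) c (a b : Q) :
  sact height_mx (c *: a + b) = c *: sact height_mx a + sact height_mx b.
  exact: sact_linear.
elim=> {x y} [|c x y x' y' _ [k [lx ly]] _ [k' [lx' ly']]|i j x y lt hE _ [k [lx ly]]].
- by exists 1; rewrite !scale1r !subrr; split; apply: LowerSum0.
- exists (c * k + k'); split; rewrite scalerDl opprD addrACA -scalerA -scalerBr;
    by apply: lower_sumD => //; apply: lower_sumZ.
exists 0; rewrite !scale0r !subr0.
have main (Q : smodule h) (q z : Q) : weight_vector mu q -> low Q (z - k *: q) ->
    low Q (sact (E i j) z).
  move=> wq lz; rewrite -(subrK (k *: q) z) sactrD // sactrZ //.
  apply: lower_sumD; last apply: lower_sumZ => //.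
    apply: lower_sum_shift lz => [c a b|a]; first exact: sact_linear.
    exact: height_low.
  apply: (lower_sum_eigen (n := (index i s - index j s).-1)).
  by rewrite prednK ?subn_gt0 // height_low // (weight_height wq) sactrZ // -scalerBl.
case: hv hw => _ wv _ [_ ww _].
by split; [apply: main wv lx|apply: main ww ly].
Qed.

Lemma hw_rel_submodule_l : submodule (fun x => exists y, rel x y).
Proof.
split=> [|c x x' [y r] [y' r']|u x [y r]|X x hX [y r]].
- by exists 0; apply: hw_rel0.
- by exists (c *: y + y'); apply: HwLin.
- by exists (spart (u (+) p) y); apply: hw_rel_spart.
- by exists (sact X y); apply: hw_rel_sact.
Qed.

Lemma hw_rel_submodule_ker : submodule (fun y => rel 0 y).
Proof.
split=> [|c y y' r r'|u y r|X y hX r].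
- exact: hw_rel0.
- by have := HwLin c r r'; rewrite scaler0 addr0.
- by have := hw_rel_spart r (u (+) p); rewrite spart0 addbK.
- by have := hw_rel_sact r hX; rewrite sactr0.
Qed.

(** The space of weight [mu] in the generated submodule is a line, which
   contains [(v, w)] and therefore not [(0, w)]. *)
Lemma hw_rel_ker : irreducible N -> forall y, rel 0 y -> y = 0.
Proof.
case=> _ irrN; have [//|all] := irrN _ hw_rel_submodule_ker.
have [c [lv lw]] := hw_rel_lower (all w).
have Hlin (Q : smodule h) k (a b : Q) :
  sact height_mx (k *: a + b) = k *: sact height_mx a + sact height_mx b.
  exact: (sact_linear (ht _)).
have eig (Q : smodule h) (q : Q) k : weight_vector mu q ->
    sact height_mx (k *: q) = height_of mu *: (k *: q).
  move=> wq; rewrite sactrZ; last exact: ht.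
  by rewrite (weight_height wq) !scalerA mulrC.
case: hv hw => v0 wv _ [w0 ww _].
have c0 : c = 0.
  have : 0 - c *: v = 0.
    by apply: lower_sum_eq0 lv _ => //; rewrite sub0r -scaleNr eig.
  rewrite sub0r => /eqP; rewrite oppr_eq0 scaler_eq0 (negbTE v0) orbF.
  by move/eqP.
have : w = 0.
  apply: lower_sum_eq0 (_ : low N w) _ => //.
    by move: lw; rewrite c0 scale0r subr0.
  by rewrite -[w]scale1r eig.
by move/eqP; rewrite (negbTE w0).
Qed.

End HighestWeightRelation.

Lemma hw_rel_sym (C : numFieldType) (h : {vspace 'M[C]_4}) (M N : smodule h) s
  (v : M) (w : N) x y : hw_rel s v w x y -> hw_rel s w v y x.
Proof.
elim=> [|c x0 y0 x' y' _ r _ r'|i j x0 y0 lt hE _ r].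
- exact: HwBase.
- exact: HwLin.
exact: HwLow.
Qed.

Section HighestWeightUniqueness.
Variables (C : numFieldType) (h : {vspace 'M[C]_4}).
Hypotheses (ht : forall d, diag_mx d \in h) (hu : unit_spanned h).
Hypothesis (hbr : forall X Y, X \in h -> Y \in h -> sbracket X Y \in h).
Variables (s : seq 'I_4).
Hypothesis (sfull : forall i, i \in s).

(** For irreducible [M] and [N], the relation generated by a pair of highest
   weight vectors is total on both sides and has no kernel on either, so it is
   the graph of an isomorphism; its parity is that of the chosen pair. *)
Lemma irreducible_hw_isom (M N : smodule h) mu :
  irreducible_hw s mu M -> irreducible_hw s mu N -> smod_isom M N.
Proof.
move=> [irrM [v0 hv0]] [irrN [w0 hw0]].
have [t [v [tv hv]]] := highest_weight_homog ht hv0.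
have [t' [w [tw hw]]] := highest_weight_homog ht hw0.
pose p := t (+) t'.
have tpw : spart (t (+) p) w = w by rewrite /p addKb.
have tpv : spart (t' (+) p) v = v by rewrite /p addbC addbK.
have totalM x : exists y, hw_rel s v w x y.
  case: irrM => _ /(_ _ (hw_rel_submodule_l hu hbr hv hw tv tpw sfull)) [z|]//.
  have := z v (ex_intro _ w (HwBase s v w)); case: hv => v1 _ _ vz.
  by rewrite vz eqxx in v1.
have totalN y : exists x, hw_rel s v w x y.
  case: irrN => _ /(_ _ (hw_rel_submodule_l hu hbr hw hv tw tpv sfull)) [z|].
    have := z w (ex_intro _ v (HwBase s w v)); case: hw => w1 _ _ wz.
    by rewrite wz eqxx in w1.
  by move=> /(_ y) [x r]; exists x; apply: hw_rel_sym.
have uniqN x y y' : hw_rel s v w x y -> hw_rel s v w x y' -> y' = y.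
  move=> r r'; apply/eqP; rewrite -subr_eq0; apply/eqP.
  apply: (hw_rel_ker ht hu hbr hv hw tv tpw sfull irrN).
  by have := HwLin (-1) r r'; rewrite !scaleN1r addNr addrC.
have uniqM x x' y : hw_rel s v w x y -> hw_rel s v w x' y -> x' = x.
  move=> /hw_rel_sym r /hw_rel_sym r'; apply/eqP; rewrite -subr_eq0; apply/eqP.
  apply: (hw_rel_ker ht hu hbr hw hv tw tpv sfull irrM).
  by have := HwLin (-1) r r'; rewrite !scaleN1r addNr addrC.
have [f fP] := choice totalM; have [g gP] := choice totalN.
exists p, f; split; last first.
  exists g => [x|y]; first exact: uniqM (fP x) (gP (f x)).
  exact: uniqN (gP y) (fP (g y)).
split=> [c x y|u x|X hX x]; apply: uniqN (fP _).
- exact: HwLin.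
- by apply: (hw_rel_spart tv tpw); apply: fP.
- by apply: (hw_rel_sact hu hbr hv hw sfull) => //; apply: fP.
Qed.

(** A second highest weight vector would generate a module all of whose
   weights are strictly lower, which leaves no room for the first one. *)
Lemma no_lower_highest_weight (M : smodule h) mu nu (v z : M) n :
  irreducible M -> highest_weight_vector s mu v -> weight_vector nu z ->
  height_of s nu = height_of s mu - n.+1%:R ->
  (forall i j, (index i s < index j s)%N -> delta_mx i j \in h ->
     sact (delta_mx i j) z = 0) -> z = 0.
Proof.
move=> [_ irrM] hv wz hn kz; apply/eqP/negPn/negP => nz.
have hz0 : highest_weight_vector s nu z by [].
have [t [u [tu hz]]] := highest_weight_homog ht hz0.
have tu' : spart (t (+) false) u = u by rewrite addbF.
have [z0|all] := irrM _ (hw_rel_submodule_l hu hbr hz hz tu tu' sfull).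
  have := z0 u (ex_intro _ u (HwBase s u u)).
  by case: hz => u0 _ _ /eqP; rewrite (negbTE u0).
have [y r] := all v; have [c [lv _]] := hw_rel_lower ht hz hz r.
have Dlin k (a b : M) : sact (height_mx C s) (k *: a + b)
    = k *: sact (height_mx C s) a + sact (height_mx C s) b.
  exact: (sact_linear (ht _)).
case: hv hz => v0 wv _ [_ wu _].
have : v = 0; last by move/eqP; rewrite (negbTE v0).
apply: (lower_sum_eq0 Dlin _ (weight_height s wv)).
have -> : height_of s mu = height_of s nu + n.+1%:R by rewrite hn subrK.
rewrite -(subrK (c *: u) v); apply: lower_sumD; first exact: lower_sumW.
apply: (lower_sum_eigen (n := n)).
by rewrite addrK (sactrZ _ _ (ht _)) (weight_height s wu) !scalerA mulrC.
Qed.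

End HighestWeightUniqueness.

(** * The action of matrix units on ordered monomials *)

(** Formal linear combinations.  The identities between products of matrix units
   that are needed below hold over the integers and are checked by computing
   with such lists. *)
Definition comb (T : Type) := seq (T * int).

Definition scalc (T : Type) (c : int) (l : comb T) : comb T :=
  [seq (t.1, c * t.2) | t <- l].

Definition mapc (T U : Type) (g : T -> U) (l : comb T) : comb U :=
  [seq (g t.1, t.2) | t <- l].

Definition bindc (T U : Type) (l : comb T) (g : T -> comb U) : comb U :=
  flatten [seq scalc t.2 (g t.1) | t <- l].

(** Zero coefficients are dropped, so that a combination vanishes when its
   collected form is empty. *)
Fixpoint addc (T : eqType) (k : T) (c : int) (l : comb T) : comb T :=
  if l is t :: l' then
    if k == t.1 then if c + t.2 == 0 then l' else (k, c + t.2) :: l'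
    else t :: addc k c l'
  else if c == 0 then [::] else [:: (k, c)].

Definition collect (T : eqType) (l : comb T) : comb T :=
  foldr (fun t => addc t.1 t.2) [::] l.

Definition lc (C : fieldType) (V : lmodType C) (T : Type) (f : T -> V)
  (l : comb T) : V := \sum_(t <- l) t.2%:~R *: f t.1.

Section CombEval.
Variables (C : fieldType) (V : lmodType C).

Lemma lc_nil (T : Type) (f : T -> V) : lc f [::] = 0.
Proof. exact: big_nil. Qed.

Lemma lc_cons (T : Type) (f : T -> V) t l :
  lc f (t :: l) = t.2%:~R *: f t.1 + lc f l.
Proof. exact: big_cons. Qed.

Lemma lc_seq1 (T : Type) (f : T -> V) k : lc f [:: (k, 1)] = f k.
Proof. by rewrite lc_cons lc_nil addr0 scale1r. Qed.

Lemma lc_cat (T : Type) (f : T -> V) l1 l2 : lc f (l1 ++ l2) = lc f l1 + lc f l2.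
Proof. exact: big_cat. Qed.

Lemma lc_scal (T : Type) (f : T -> V) c l : lc f (scalc c l) = c%:~R *: lc f l.
Proof.
rewrite /lc big_map scaler_sumr; apply: eq_bigr => t _.
by rewrite /= intrM scalerA.
Qed.

Lemma lc_map (T U : Type) (f : U -> V) (g : T -> U) l :
  lc f (mapc g l) = lc (f \o g) l.
Proof. exact: big_map. Qed.

Lemma lc_bind (T U : Type) (f : U -> V) l (g : T -> comb U) :
  lc f (bindc l g) = lc (fun t => lc f (g t)) l.
Proof.
elim: l => [|t l IH]; first by rewrite !lc_nil.
by rewrite /bindc /= lc_cat lc_scal -/(bindc l g) IH lc_cons.
Qed.

Lemma eq_lc_in (T : eqType) (f g : T -> V) l :
  (forall t, t \in l -> f t.1 = g t.1) -> lc f l = lc g l.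
Proof. by move=> fg; apply: eq_big_seq => t /fg ->. Qed.

Lemma eq_lc (T : Type) (f g : T -> V) l : f =1 g -> lc f l = lc g l.
Proof. by move=> fg; apply: eq_bigr => t _; rewrite fg. Qed.

Lemma lc_add (T : eqType) (f : T -> V) k c l :
  lc f (addc k c l) = c%:~R *: f k + lc f l.
Proof.
elim: l => [|[k' c'] l IH] /=.
  case: eqP => [->|_]; first by rewrite lc_nil scale0r addr0.
  by rewrite lc_cons.
case: (k =P k') => [->|_]; last by rewrite !lc_cons IH addrCA.
rewrite lc_cons addrA -scalerDl -intrD; case: (c + c' =P 0) => [->|_].
  by rewrite scale0r add0r.
by rewrite lc_cons.
Qed.

Lemma lc_collect (T : eqType) (f : T -> V) l : lc f (collect l) = lc f l.
Proof. by elim: l => //= t l IH; rewrite lc_add lc_cons IH. Qed.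

End CombEval.

Lemma lin_lc (C : fieldType) (V U : lmodType C) (A : V -> U) (T : Type) (f : T -> V) l :
  (forall c x y, A (c *: x + y) = c *: A x + A y) ->
  A (lc f l) = lc (A \o f) l.
Proof.
move=> lin; rewrite /lc (lin_fun_sum lin); apply: eq_bigr => t _.
exact: lin_funZ.
Qed.

(** Pairs of indices stand for matrix units, so that one can compute with them. *)
Definition letter : eqType := ('I_4 * 'I_4)%type.

Definition lpar (p : letter) : bool := odd_idx p.1 (+) odd_idx p.2.

Definition lbr (p q : letter) : comb letter :=
  (if p.2 == q.1 then [:: ((p.1, q.2), 1)] else [::]) ++
  (if q.2 == p.1 then [:: ((q.1, p.2), if lpar p && lpar q then 1 else -1)]
   else [::]).

(** The lowering elements, in the order [E31, E32, E41, E42]; thus the elements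
   [xi11] and [xi22] of the theorem have the numbers 0 and 3. *)
Definition xi_unit (b : nat) : letter :=
  (if (b < 2)%N then x3 else x4, if odd b then x2 else x1).

Definition is_xi (p : letter) : bool := odd_idx p.1 && ~~ odd_idx p.2.

Definition xi_index (p : letter) : nat := ((p.1 == x4).*2 + (p.2 == x2))%N.

(** The product of a lowering element with an increasing monomial, rewritten in
   increasing order: each transposition of anticommuting factors costs a sign,
   and a repeated factor gives zero. *)
Fixpoint xi_insert (b : nat) (s : seq nat) : comb (seq nat) :=
  if s is c :: s' then
    if (b < c)%N then [:: (b :: s, 1)]
    else if b == c then [::]
    else scalc (-1) (mapc (cons c) (xi_insert b s'))
  else [:: ([:: b], 1)].

(** A pair [(s, u)] stands for the monomial [s] in the [xi] applied to the
   result of the word [u] of even matrix units. *)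
Definition pbw : eqType := (seq nat * seq letter)%type.

(** The matrix unit [p] applied to the monomial [s]: it is moved to the right
   until it reaches the inducing module, where the raising units vanish. *)
Fixpoint kac_act (p : letter) (s : seq nat) : comb pbw :=
  if is_xi p then mapc (fun s' => (s', [::])) (xi_insert (xi_index p) s)
  else if s is b :: s' then collect
     (scalc (if lpar p then -1 else 1)
        (bindc (kac_act p s') (fun k => mapc (fun r => (r, k.2)) (xi_insert b k.1)))
      ++ bindc (lbr p (xi_unit b)) (fun q => kac_act q s'))
  else if lpar p then [::] else [:: (([::], [:: p]), 1)].

Definition unit_act (C : fieldType) (h : {vspace 'M[C]_4}) (M : smodule h)
  (p : letter) (x : M) : M := sact (delta_mx p.1 p.2) x.

(** An odd matrix unit acts by zero, as on the module extended from the even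
   subalgebra by letting the raising part act trivially. *)
Definition even_act (C : fieldType) (W : smodule (gl22_even C)) (p : letter)
  (w : W) : W := sact (mxpart false (delta_mx p.1 p.2)) w.

Definition word_act (C : fieldType) (W : smodule (gl22_even C)) (u : seq letter)
  (w : W) : W := foldr (@even_act C W) w u.

Definition xi_word (C : fieldType) (K : smodule (gl22 C)) (s : seq nat)
  (y : K) : K := foldr (fun b => unit_act (xi_unit b)) y s.

Section UnitActions.
Variables (C : fieldType) (h : {vspace 'M[C]_4}).
Local Notation E p := (delta_mx p.1 p.2 : 'M[C]_4).

Lemma sbracket_lbr p q : sbracket (E p) (E q) = lc (fun r => E r) (lbr p q).
Proof.
rewrite sbracket_delta lc_cat; congr (_ + _).
  by case: eqP; rewrite ?lc_nil // lc_seq1.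
rewrite -scaleNr -/(lpar p) -/(lpar q).
case: eqP => _; last by rewrite mulr0n scaler0 lc_nil.
rewrite lc_cons lc_nil addr0 mulr1n; congr (_ *: _).
by case: (_ && _); rewrite ?expr0 // expr1 opprK.
Qed.

Lemma unit_act_comm (M : smodule h) p q (x : M) : E p \in h -> E q \in h ->
  unit_act p (unit_act q x)
  = (-1) ^+ (lpar p && lpar q) *: unit_act q (unit_act p x)
    + sact (lc (fun r => E r) (lbr p q)) x.
Proof.
move=> hp hq; rewrite -sbracket_lbr.
rewrite (sact_bracket x hp hq (mxpart_delta C p.1 p.2) (mxpart_delta C q.1 q.2)).
by rewrite addrC subrK.
Qed.

End UnitActions.

Section FullUnitActions.
Variables (C : fieldType) (K : smodule (gl22 C)).

Lemma unit_act_lin p c (x y : K) :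
  unit_act p (c *: x + y) = c *: unit_act p x + unit_act p y.
Proof. by apply: sact_linear; rewrite memvf. Qed.

Lemma unit_act_comm22 p q (x : K) :
  unit_act p (unit_act q x)
  = (-1) ^+ (lpar p && lpar q) *: unit_act q (unit_act p x)
    + lc (fun r => unit_act r x) (lbr p q).
Proof.
rewrite unit_act_comm ?memvf //; congr (_ + _).
rewrite (lin_lc (A := fun X => sact X x)) // => c X Y.
by apply: sact_linearl; rewrite memvf.
Qed.

Lemma xi_unit_comm b c (x : K) :
  unit_act (xi_unit b) (unit_act (xi_unit c) x)
  = - unit_act (xi_unit c) (unit_act (xi_unit b) x).
Proof.
rewrite unit_act_comm22 [lbr _ _](_ : _ = [::]) ?lc_nil ?addr0 -?scaleN1r; last first.
  by rewrite /lbr /xi_unit; case: (b < 2)%N; case: (c < 2)%N; case: (odd b); case: (odd c).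
congr (_ *: _); rewrite /xi_unit /lpar.
by case: (b < 2)%N; case: (c < 2)%N; case: (odd b); case: (odd c).
Qed.

End FullUnitActions.

Lemma even_act_odd (C : fieldType) (W : smodule (gl22_even C)) p (w : W) :
  lpar p -> even_act p w = 0.
Proof. by move=> hp; rewrite /even_act mxpart_even_delta -/(lpar p) hp sactl0. Qed.

Section KacTable.
Variables (C : numFieldType) (K : smodule (gl22 C)).
Implicit Types (x y : K).

Lemma xi_unit_sqr b x : unit_act (xi_unit b) (unit_act (xi_unit b) x) = 0.
Proof.
set y := unit_act _ _; have y2 : 2%:R *: y = 0.
  by rewrite scaler_nat mulr2n {1}/y xi_unit_comm addNr.
by apply/eqP; move/eqP: y2; rewrite scaler_eq0 pnatr_eq0.
Qed.

Lemma xi_word_lin s c x y : xi_word s (c *: x + y) = c *: xi_word s x + xi_word s y.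
Proof. by elim: s => //= b s ->; rewrite unit_act_lin. Qed.

Lemma xi_word0 s : xi_word s (0 : K) = 0.
Proof. exact/lin_fun0/xi_word_lin. Qed.

Lemma xi_insertP b s y :
  unit_act (xi_unit b) (xi_word s y) = lc (fun r => xi_word r y) (xi_insert b s).
Proof.
elim: s => [|c s IH] /=; first by rewrite lc_seq1.
case: ltngtP => [lt|gt|->]; rewrite ?lc_seq1 //; last first.
  by rewrite xi_unit_sqr lc_nil.
rewrite lc_scal lc_map xi_unit_comm IH (lin_lc _ _ (unit_act_lin (xi_unit c))).
by rewrite scaleN1r.
Qed.

Variables (W : smodule (gl22_even C)) (i : W -> K).
Hypothesis (hi : smod_hom (h1 := gl22_par C) (gl22_par C) false
                   (M := inflate W) i).

Lemma induced_unit_act p w : ~~ is_xi p ->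
  unit_act p (i w) = i (even_act p w).
Proof.
case: hi => _ _ homi np; rewrite /unit_act -homi //.
apply: delta_mxspan; move: np; rewrite /is_xi.
by case: (odd_idx p.1); case: (odd_idx p.2).
Qed.

Lemma induced0 : i 0 = 0.
Proof.
by case: hi => lin _ _; apply: lin_fun0 lin.
Qed.

(** The table is forced by the bracket relations and by the action on the
   inducing module, so it is valid in every module that receives a map from the
   latter, before anything is known about freeness. *)
Lemma kac_actP p s w : unit_act p (xi_word s (i w))
  = lc (fun k => xi_word k.1 (i (word_act k.2 w))) (kac_act p s).
Proof.
elim: s p => [|b s IH] p /=; case: ifPn => [xp|nxp].
- have {1}-> : p = xi_unit (xi_index p).
    move: xp; case: p => [[[|[|[|[|?]]]] ?] [[|[|[|[|?]]]] ?]] //= _;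
      by congr (_, _); apply: val_inj.
  by rewrite (xi_insertP _ [::]) !lc_seq1.
- rewrite induced_unit_act //; case: ifP => [op|_]; last by rewrite lc_seq1.
  by rewrite even_act_odd // induced0 lc_nil.
- have {1}-> : p = xi_unit (xi_index p).
    move: xp; case: p => [[[|[|[|[|?]]]] ?] [[|[|[|[|?]]]] ?]] //= _;
      by congr (_, _); apply: val_inj.
  by rewrite (xi_insertP _ (b :: s)) lc_map.
rewrite lc_collect lc_cat lc_scal lc_bind unit_act_comm22; congr (_ + _); last first.
  by rewrite lc_bind; apply: eq_lc => q; rewrite IH.
have -> : lpar (xi_unit b) by rewrite /xi_unit /lpar; case: (b < 2)%N; case: odd.
rewrite andbT [in LHS]IH (lin_lc _ _ (unit_act_lin _)); congr (_ *: _).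
  by case: (lpar p).
by apply: eq_lc => k /=; rewrite xi_insertP lc_map.
Qed.

End KacTable.

(** * The Kac module on sixteen copies of the inducing module *)

Definition letters : seq letter :=
  allpairs pair [:: x1; x2; x3; x4] [:: x1; x2; x3; x4].

(** The monomial of number [n] has the binary digits of [n] as exponents, so that
   a monomial comes after all its divisors. *)
Definition xi_monomials : seq (seq nat) :=
  [seq [seq b <- iota 0 4 | odd (n %/ 2 ^ b)] | n <- iota 0 16].

Definition kac_act_comb (p : letter) (l : comb pbw) : comb pbw :=
  bindc l (fun k => mapc (fun r => (r.1, r.2 ++ k.2)) (kac_act p k.1)).

Definition bracket_defect (p q : letter) (s : seq nat) : comb pbw :=
  kac_act_comb p (kac_act q s)
  ++ (scalc (if lpar p && lpar q then 1 else -1) (kac_act_comb q (kac_act p s))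
  ++ scalc (-1) (bindc (lbr p q) (fun r => kac_act r s))).

(** Words of length two are put in increasing order; the table never produces
   longer words in a single bracket. *)
Definition sort_word (k : pbw) : comb pbw :=
  if k.2 is [:: p; q] then
    if [&& ~~ lpar p, ~~ lpar q & (q.1 * 4 + q.2 < p.1 * 4 + p.2)%N] then
      ((k.1, [:: q; p]), 1) :: mapc (fun r => (k.1, [:: r])) (lbr p q)
    else [:: (k, 1)]
  else [:: (k, 1)].

Lemma mem_letters p : p \in letters.
Proof. by case: p => [[[|[|[|[|?]]]] ?] [[|[|[|[|?]]]] ?]]. Qed.

Lemma kac_act_wf p s t : s \in xi_monomials -> t \in kac_act p s ->
  [&& t.1.1 \in xi_monomials, odd (size t.1.1) == lpar p (+) odd (size s)
    & all (fun q => ~~ lpar q) t.1.2].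
Proof.
move=> hs; apply/allP: t; move: s hs; apply/allP; move: p (mem_letters p).
by apply/allP; vm_compute.
Qed.

(** All the bracket relations of the Kac module, on all monomials.  The
   computation uses no more of the inducing module than the relations of the
   even subalgebra, through the reordering of words. *)
Lemma bracket_defect0 p q s : s \in xi_monomials ->
  collect (bindc (collect (bracket_defect p q s)) sort_word) = [::].
Proof.
move=> hs; apply/eqP; move: s hs; apply/allP; move: q (mem_letters q).
apply/allP; move: p (mem_letters p); apply/allP.
by vm_compute.
Qed.

Section KacModel.
Variables (C : fieldType) (W : smodule (gl22_even C)).
Local Notation model := {ffun 'I_16 -> W}.
Local Notation mon k := (nth [::] xi_monomials (k : 'I_16)).
Implicit Types (x y : model).

Lemma even_act_lin p c (v w : W) :
  even_act p (c *: v + w) = c *: even_act p v + even_act p w.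
Proof. by apply: sact_linear; apply: mxpart_even. Qed.

Lemma word_act_lin u c (v w : W) :
  word_act u (c *: v + w) = c *: word_act u v + word_act u w.
Proof. by elim: u => //= p u ->; rewrite even_act_lin. Qed.

Lemma even_act_comm p q (w : W) : ~~ lpar p -> ~~ lpar q ->
  even_act p (even_act q w)
  = even_act q (even_act p w) + lc (fun r => even_act r w) (lbr p q).
Proof.
have par (r : letter) : ~~ lpar r -> delta_mx r.1 r.2 \in gl22_par C.
  by rewrite /lpar => np; apply: delta_mxspan; move: np;
    case: (odd_idx r.1); case: (odd_idx r.2).
move=> ep eq; have := @sact_bracket _ _ (inflate W) _ _ _ _ w (par p ep) (par q eq)
  (mxpart_delta C p.1 p.2) (mxpart_delta C q.1 q.2).
rewrite /lpar in ep eq; rewrite (negbTE ep) (negbTE eq) expr0 scale1r sbracket_lbr.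
rewrite (lin_lc (A := fun X => @sact _ _ (inflate W) X w)); last first.
  move=> c X Y; rewrite /= mxpart_linear.
  by apply: sact_linearl; apply: mxpart_even.
by move=> e; apply/eqP; rewrite addrC -subr_eq; apply/eqP/esym/e.
Qed.

Lemma word_act_spart u t (w : W) : all (fun q => ~~ lpar q) u ->
  spart t (word_act u w) = word_act u (spart t w).
Proof.
elim: u => //= p u IH /andP[ep eu]; rewrite -IH //.
rewrite -[in LHS](addFb t); apply: spart_sact; first exact: mxpart_even.
by rewrite mxpart_proj.
Qed.

(** The model of the Kac module is a copy of the inducing module for each
   monomial; [model_inj s w] stands for the monomial [s] applied to [w]. *)
Definition model_inj (s : seq nat) (w : W) : model :=
  [ffun k => if mon k == s then w else 0].

Definition model_key (w : W) (k : pbw) : model := model_inj k.1 (word_act k.2 w).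

Definition model_unit (p : letter) x : model :=
  \sum_(k : 'I_16) lc (model_key (x k)) (kac_act p (mon k)).

Definition model_act (X : 'M[C]_4) x : model :=
  \sum_i \sum_j X i j *: model_unit (i, j) x.

Definition model_part (t : bool) x : model :=
  [ffun k => spart (t (+) odd (size (mon k))) (x k)].

Lemma model_inj_lin s c v w :
  model_inj s (c *: v + w) = c *: model_inj s v + model_inj s w.
Proof. by apply/ffunP=> k; rewrite !ffunE; case: eqP; rewrite ?scaler0 ?addr0. Qed.

Lemma model_inj0 s : model_inj s 0 = 0.
Proof. by apply/ffunP=> k; rewrite !ffunE if_same. Qed.

Lemma mon_inj (k l : 'I_16) : (mon k == mon l) = (k == l).
Proof. by rewrite nth_uniq. Qed.

Lemma monP s : s \in xi_monomials -> exists k : 'I_16, mon k = s.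
Proof.
move=> hs; have lt : (index s xi_monomials < 16)%N by rewrite -[16%N]/(size xi_monomials) index_mem.
by exists (Ordinal lt); rewrite nth_index.
Qed.

Lemma mon_mem (k : 'I_16) : mon k \in xi_monomials.
Proof. exact: mem_nth. Qed.

Lemma model_expand x : x = \sum_k model_inj (mon k) (x k).
Proof.
apply/ffunP=> k; rewrite sum_ffunE (bigD1 k) //= ffunE eqxx big1 ?addr0 //.
by move=> l nl; rewrite ffunE mon_inj eq_sym (negbTE nl).
Qed.

Lemma model_unit_lin p c x y :
  model_unit p (c *: x + y) = c *: model_unit p x + model_unit p y.
Proof.
rewrite /model_unit scaler_sumr -big_split; apply: eq_bigr => k _ /=.
rewrite /lc scaler_sumr -big_split; apply: eq_bigr => t _ /=.
by rewrite !ffunE /model_key word_act_lin model_inj_lin scalerDr !scalerA mulrC.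
Qed.

Lemma model_unit_inj p s w : s \in xi_monomials ->
  model_unit p (model_inj s w) = lc (model_key w) (kac_act p s).
Proof.
case/monP=> k <-; rewrite /model_unit (bigD1 k) //= ffunE eqxx big1 ?addr0 // => l nl.
rewrite ffunE mon_inj (negbTE nl) /lc big1 // => t _.
rewrite /model_key; suff -> : word_act t.1.2 (0 : W) = 0 by rewrite model_inj0 scaler0.
exact/lin_fun0/word_act_lin.
Qed.

Lemma model_unit_comb p w l : (forall t, t \in l -> t.1.1 \in xi_monomials) ->
  model_unit p (lc (model_key w) l) = lc (model_key w) (kac_act_comb p l).
Proof.
move=> hl; rewrite (lin_lc _ _ (model_unit_lin p)) lc_bind.
apply: eq_lc_in => t /hl ht; rewrite /= /model_key model_unit_inj // lc_map.
by apply: eq_lc => r; rewrite /= /model_key /word_act foldr_cat.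
Qed.

Lemma sort_wordP w k : lc (model_key w) (sort_word k) = model_key w k.
Proof.
case: k => s u; rewrite /sort_word /=; case: u => [|p [|q [|? ?]]]; rewrite ?lc_seq1 //.
case: and3P => [[ep eq _]|_]; last by rewrite lc_seq1.
rewrite lc_cons scale1r lc_map /model_key /= [in RHS]even_act_comm //.
rewrite -[even_act q _]scale1r model_inj_lin !scale1r; congr (_ + _).
by rewrite (lin_lc _ _ (model_inj_lin s)).
Qed.

(** Both sides are given by the table on each monomial, where their difference
   is the combination that was found to vanish. *)
Lemma model_unit_comm p q x :
  model_unit p (model_unit q x)
  - (-1) ^+ (lpar p && lpar q) *: model_unit q (model_unit p x)
  = lc (fun r => model_unit r x) (lbr p q).
Proof.
have sum0 r (F : 'I_16 -> model) : model_unit r (\sum_k F k) = \sum_k model_unit r (F k).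
  by apply: lin_fun_sum; apply: model_unit_lin.
rewrite (model_expand x) !sum0 scaler_sumr -sumrB.
rewrite [RHS](_ : _ = \sum_k
    lc (fun r => model_unit r (model_inj (mon k) (x k))) (lbr p q)); last first.
  rewrite /lc exchange_big; apply: eq_bigr => t _ /=.
  by rewrite sum0 scaler_sumr.
apply: eq_bigr => k _; move: (x k) (mon k) (mon_mem k) => w s hs; apply/eqP.
rewrite -subr_eq0; apply/eqP.
have wf r t : t \in kac_act r s -> t.1.1 \in xi_monomials.
  by move/(kac_act_wf hs)/and3P => [].
have defect : lc (model_key w) (bracket_defect p q s) = 0.
  rewrite -lc_collect -[LHS](eq_lc _ (sort_wordP w)) -lc_bind -lc_collect.
  by rewrite bracket_defect0 // lc_nil.
rewrite -[RHS]defect /bracket_defect; move: (lbr p q) => L; rewrite !lc_cat !lc_scal lc_bind.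
rewrite !model_unit_inj // !model_unit_comb; try exact: wf.
rewrite -addrA -scaleNr; congr (_ + (_ *: _ + _)).
  by case: (_ && _); rewrite ?expr0 // expr1 opprK.
rewrite scaleN1r; congr (- _); apply: eq_lc => r.
by rewrite model_unit_inj.
Qed.

Lemma model_part_lin t c x y :
  model_part t (c *: x + y) = c *: model_part t x + model_part t y.
Proof. by apply/ffunP=> k; rewrite !ffunE spart_linear. Qed.

Lemma model_unit_part p t x :
  model_part (lpar p (+) t) (model_unit p x) = model_unit p (model_part t x).
Proof.
rewrite /model_unit (lin_fun_sum (model_part_lin _)); apply: eq_bigr => k _.
rewrite ffunE [LHS](lin_fun_sum (model_part_lin _)).
apply: eq_big_seq => -[[s u] c] /(kac_act_wf (mon_mem k)) /=.
case/and3P=> hs /eqP os eu; apply/ffunP=> l; rewrite !ffunE /=.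
rewrite spartZ; case: eqP => [->|_]; last by rewrite spart0.
rewrite word_act_spart //; congr (_ *: word_act u (spart _ _)).
by rewrite os addbACA addbb addFb.
Qed.

Lemma model_act_delta p x : model_act (delta_mx p.1 p.2) x = model_unit p x.
Proof.
rewrite /model_act (bigD1 p.1) //= (bigD1 p.2) //= mxE !eqxx scale1r -surjective_pairing.
rewrite !big1 ?addr0 // => [i ni|j nj]; last by rewrite mxE (negbTE nj) andbF scale0r.
by apply: big1 => j _; rewrite mxE (negbTE ni) scale0r.
Qed.

Lemma model_act_linear X c x y :
  model_act X (c *: x + y) = c *: model_act X x + model_act X y.
Proof.
rewrite /model_act scaler_sumr -big_split; apply: eq_bigr => i _ /=.
rewrite scaler_sumr -big_split; apply: eq_bigr => j _ /=.
by rewrite model_unit_lin scalerDr !scalerA mulrC.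
Qed.

Lemma model_act_linearl c X Y x :
  model_act (c *: X + Y) x = c *: model_act X x + model_act Y x.
Proof.
rewrite /model_act scaler_sumr -big_split; apply: eq_bigr => i _ /=.
rewrite scaler_sumr -big_split; apply: eq_bigr => j _ /=.
by rewrite !mxE scalerDl scalerA.
Qed.

Lemma homog_coef s (X : 'M[C]_4) i j : mxpart s X = X -> X i j != 0 ->
  odd_idx i (+) odd_idx j = s.
Proof.
move=> sX; rewrite -sX mxE; case: (_ =P s) => [//|_].
by rewrite eqxx.
Qed.

Lemma model_act_part s t X x : mxpart s X = X ->
  model_part t x = x -> model_part (s (+) t) (model_act X x) = model_act X x.
Proof.
move=> sX tx.
rewrite {1}/model_act (lin_fun_sum (model_part_lin _)); apply: eq_bigr => i _.
rewrite (lin_fun_sum (model_part_lin _)); apply: eq_bigr => j _.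
rewrite (lin_funZ (model_part_lin _)).
have [->|nz] := eqVneq (X i j) 0; first by rewrite !scale0r.
by rewrite -(homog_coef sX nz) -[_ (+) odd_idx j]/(lpar (i, j)) model_unit_part tx.
Qed.

Lemma model_act_bracket s t X Y x : mxpart s X = X -> mxpart t Y = Y ->
  model_act (sbracket X Y) x
  = model_act X (model_act Y x) - (-1) ^+ (s && t) *: model_act Y (model_act X x).
Proof.
move=> sX tY.
pose B (Z T : 'M[C]_4) := model_act (Z *m T - (-1) ^+ (s && t) *: (T *m Z)) x.
pose B' Z T := model_act Z (model_act T x)
  - (-1) ^+ (s && t) *: model_act T (model_act Z x).
rewrite (sbracket_homog sX tY) -/(B X Y) -/(B' X Y).
have expand (A : 'M[C]_4 -> model) Z :
    (forall c a b, A (c *: a + b) = c *: A a + A b) ->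
    A Z = \sum_i \sum_j Z i j *: A (delta_mx i j).
  move=> lin; rewrite {1}(matrix_sum_delta Z) (lin_fun_sum lin).
  apply: eq_bigr => i _; rewrite (lin_fun_sum lin).
  by apply: eq_bigr => j _; rewrite (lin_funZ lin).
have linBl T c a b : B (c *: a + b) T = c *: B a T + B b T.
  rewrite -model_act_linearl /B mulmxDl mulmxDr -scalemxAl -scalemxAr.
  congr model_act; rewrite !scalerDr scalerN !scalerA opprD addrACA.
  by rewrite [_ * c]mulrC.
have linBr T c a b : B T (c *: a + b) = c *: B T a + B T b.
  rewrite -model_act_linearl /B mulmxDl mulmxDr -scalemxAl -scalemxAr.
  congr model_act; rewrite !scalerDr scalerN !scalerA opprD addrACA.
  by rewrite [_ * c]mulrC.
have linB'l T c a b : B' (c *: a + b) T = c *: B' a T + B' b T.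
  rewrite /B' !model_act_linearl model_act_linear !scalerDr scalerN !scalerA opprD addrACA.
  by rewrite [_ * c]mulrC.
have linB'r T c a b : B' T (c *: a + b) = c *: B' T a + B' T b.
  rewrite /B' !model_act_linearl model_act_linear !scalerDr scalerN !scalerA opprD addrACA.
  by rewrite [_ * c]mulrC.
rewrite (expand (B^~ Y) X (linBl Y)) (expand (B'^~ Y) X (linB'l Y)).
apply: eq_bigr => i _; apply: eq_bigr => j _.
have [->|nzX] := eqVneq (X i j) 0; first by rewrite !scale0r.
congr (_ *: _); rewrite (expand _ Y (linBr _)) (expand _ Y (linB'r _)).
apply: eq_bigr => k _; apply: eq_bigr => l _.
have [->|nzY] := eqVneq (Y k l) 0; first by rewrite !scale0r.
congr (_ *: _); rewrite /B /B' -(homog_coef sX nzX) -(homog_coef tY nzY).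
rewrite -(sbracket_homog (mxpart_delta C i j) (mxpart_delta C k l)).
rewrite (sbracket_lbr C (i, j) (k, l)).
rewrite (lin_lc (A := fun Z => model_act Z x)) => [|c a b]; last exact: model_act_linearl.
have unitE a b y : model_act (delta_mx a b) y = model_unit (a, b) y.
  exact: (model_act_delta (a, b)).
rewrite !unitE [RHS]model_unit_comm; apply: eq_lc => r /=.
exact: model_act_delta.
Qed.

Definition kac_model : smodule (gl22 C).
Proof.
refine (@SModule C (gl22 C) model model_part model_act _ _ _ _ _ _ _).
- by move=> s c x y; apply/ffunP=> k; rewrite !ffunE spart_linear.
- move=> x; apply/ffunP=> k; rewrite !ffunE.
  by case: odd; rewrite /= ?spart_sum // addrC spart_sum.
- move=> s t x; apply/ffunP=> k; rewrite !ffunE spart_proj.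
  rewrite (inj_eq (can_inj (addbK _))).
  by case: eqP => _; rewrite ffunE.
- by move=> X _ c x y; apply: model_act_linear.
- by move=> X Y _ _ c x; apply: model_act_linearl.
- by move=> s t X x _; apply: model_act_part.
- by move=> s t X Y x _ _; apply: model_act_bracket.
Defined.

Lemma model_inj_hom :
  @smod_hom C (gl22_par C) false (gl22_par C) (gl22 C) (inflate W) kac_model
    (model_inj [::]).
Proof.
split=> [c v w|s v|X hX v]; first exact: model_inj_lin.
  apply/ffunP=> k; rewrite !ffunE addbF; case: eqP => [->|_]; last by rewrite spart0.
  by rewrite addbF.
rewrite (sact_delta_sum v (@unit_spanned_mxspan _ _) hX).
have lin := model_inj_lin [::].
rewrite (lin_fun_sum lin) /= /model_act; apply: eq_bigr => i _.
rewrite (lin_fun_sum lin) [RHS](bigID (fun j => X i j != 0)) /= [X in _ = _ + X]big1.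
  rewrite addr0; apply: eq_bigr => j nz.
  rewrite (lin_funZ lin); congr (_ *: _); rewrite model_unit_inj //=.
  have := unit_spanned_mxspan hX nz => /mem_mxspan par.
  have /negbTE-> : ~~ is_xi (i, j).
    rewrite /is_xi /=; apply/negP => /andP[oi ej].
    have := par i j; rewrite oi (negbTE ej) mxE !eqxx => /(_ isT) /eqP.
    by rewrite oner_eq0.
  case: ifP => [op|_]; last by rewrite lc_seq1.
  by rewrite lc_nil -[sact _ _]/(even_act (i, j) v) even_act_odd // model_inj0.
by move=> j /negPn/eqP ->; rewrite scale0r.
Qed.

End KacModel.

Lemma kac_act_xi b s : b :: s \in xi_monomials ->
  s \in xi_monomials /\ kac_act (xi_unit b) s = [:: ((b :: s, [::]), 1)].
Proof.
have check : all (fun r => if r is c :: r' then (r' \in xi_monomials)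
    && (kac_act (xi_unit c) r' == [:: ((r, [::]), 1)]) else true) xi_monomials.
  by vm_compute.
by move/(allP check)/andP => [hs /eqP].
Qed.

Lemma xi_word_model (C : fieldType) (W : smodule (gl22_even C)) s (w : W) :
  s \in xi_monomials ->
  xi_word (K := kac_model W) s (model_inj [::] w) = model_inj s w.
Proof.
elim: s => // b s IH /kac_act_xi[hs tab].
rewrite -[LHS]/(model_act (delta_mx (xi_unit b).1 (xi_unit b).2)
  (xi_word (K := kac_model W) s (model_inj [::] w))).
rewrite IH // model_act_delta model_unit_inj // tab.
by rewrite [LHS]lc_seq1.
Qed.

Section KacStructure.
Variables (C : numFieldType) (W : smodule (gl22_even C)) (K : smodule (gl22 C)).
Variable i : W -> K.
Hypothesis hK : is_Kac i.

Local Notation mon k := (nth [::] xi_monomials (k : 'I_16)).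

Definition of_model (x : kac_model W) : K := \sum_(k : 'I_16) xi_word (mon k) (i (x k)).

Let hi : @smod_hom C (gl22_par C) false (gl22_par C) (gl22 C) (inflate W) K i.
Proof. by case: hK. Qed.

Let ilin c v w : i (c *: v + w) = c *: i v + i w.
Proof. by case: hi => lin _ _; apply: lin. Qed.

Lemma spart_xi_word s t (y : K) :
  spart (t (+) odd (size s)) (xi_word s y) = xi_word s (spart t y).
Proof.
elim: s t => [|b s IH] t /=; first by rewrite addbF.
have pb : lpar (xi_unit b) by rewrite /xi_unit /lpar; case: (b < 2)%N; case: odd.
rewrite -IH /unit_act -(spart_sact _ _ (memvf _) (mxpart_delta C _ _)) -/(lpar _) pb.
by rewrite addTb addbN.
Qed.

(** The table that defines the action on the model is valid in [K]. *)
Lemma of_model_hom : smod_hom (gl22 C) false of_model.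
Proof.
have lin c (x y : kac_model W) : of_model (c *: x + y) = c *: of_model x + of_model y.
  rewrite /of_model scaler_sumr -big_split; apply: eq_bigr => k _ /=.
  by rewrite !ffunE ilin xi_word_lin.
split=> // [s x|X _ x].
  rewrite /of_model (lin_fun_sum (spart_linear _)); apply: eq_bigr => k _; rewrite ffunE addbF.
  case: hi => _ ipart _.
  have := ipart (s (+) odd (size (mon k))) (x k); rewrite addbF /= => ->.
  by rewrite -spart_xi_word addbK.
rewrite [RHS](sact_delta_sum _ (@unit_spanned_gl22 C) (memvf X)) /= /model_act.
rewrite (lin_fun_sum lin); apply: eq_bigr => a _.
rewrite (lin_fun_sum lin) (bigID (fun b => X a b != 0)) /= [X in _ + X]big1.
  rewrite addr0; apply: eq_bigr => b _; rewrite (lin_funZ lin); congr (_ *: _).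
  rewrite /model_unit (lin_fun_sum lin) [of_model x]/of_model.
  rewrite (lin_fun_sum (sact_linear (memvf _))).
  apply: eq_bigr => k _; rewrite [RHS](kac_actP hi (a, b)).
  rewrite (lin_lc (V := {ffun 'I_16 -> W}) (A := of_model) _ _ lin).
  apply: eq_lc_in => t /(kac_act_wf (mon_mem k)) /and3P[ht _ _].
  rewrite /= /of_model /model_key; case/monP: ht => l <-.
  rewrite (bigD1 l) //= ffunE eqxx big1 ?addr0 // => m nm.
  by rewrite ffunE mon_inj (negbTE nm) (induced0 hi) xi_word0.
by move=> b /negPn/eqP ->; rewrite scale0r (lin_fun0 lin).
Qed.

(** The universal property of [K] gives a map to the model.  Composed with
   [of_model] it is the identity of [K] by uniqueness, and in the other order it
   is the identity because the model is spanned by monomials. *)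
Lemma Kac_structure : exists f : K -> kac_model W,
  cancel f of_model /\ cancel of_model f.
Proof.
case: hK => _ univ.
have [F [homF Fi uniqF]] := univ _ _ (model_inj_hom W).
have [Flin Fpart Fact] := homF.
have [Glin Gpart Gact] := of_model_hom.
exists F; split=> x.
  have [H [_ _ uniqH]] := univ _ _ hi.
  rewrite [RHS](_ : x = H x); last first.
    by apply: (uniqH idfun) => //; split=> // s y; rewrite addbF.
  apply: (uniqH (of_model \o F)) => [|w] /=; last first.
    rewrite Fi /of_model (bigD1 ord0) //= ffunE /= big1 ?addr0 // => k nk.
    by rewrite ffunE (mon_inj k ord0) (negbTE nk) (induced0 hi) xi_word0.
  split=> [c y z|s y|X hX y] /=.
  - by rewrite Flin Glin.
  - by rewrite Fpart Gpart !addbF.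
  - by rewrite Fact ?Gact.
rewrite /of_model (lin_fun_sum Flin) [RHS]model_expand; apply: eq_bigr => k _.
rewrite -(xi_word_model (x k) (mon_mem k)) -Fi.
elim: (mon k) => //= b s <-.
by rewrite /unit_act Fact ?memvf.
Qed.

End KacStructure.

(** * Irreducibility of typical Kac modules *)

Section KacWords.
Variables (C : numFieldType) (W : smodule (gl22_even C)) (K : smodule (gl22 C)).
Variable i : W -> K.
Hypothesis hK : is_Kac i.
Local Notation mon k := (nth [::] xi_monomials (k : 'I_16)).

Lemma Kac_hom :
  @smod_hom C (gl22_par C) false (gl22_par C) (gl22 C) (inflate W) K i.
Proof. by case: hK. Qed.

(** With the next lemma this is what is left of the Poincare-Birkhoff-Witt
   theorem: the Kac module is spanned by monomials applied to the inducing
   module, on which each monomial is injective. *)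
Lemma Kac_expand (x : K) :
  exists y : 'I_16 -> W, x = \sum_k xi_word (mon k) (i (y k)).
Proof.
by have [f [fK _]] := Kac_structure hK; exists (f x); rewrite -[LHS]fK.
Qed.

Lemma Kac_free s (w : W) : s \in xi_monomials -> xi_word s (i w) = 0 -> w = 0.
Proof.
have [f [_ gK]] := Kac_structure hK; have [glin _ _] := of_model_hom hK.
case/monP=> k <- eq0.
have injE : of_model i (model_inj (mon k) w) = 0.
  rewrite /of_model (bigD1 k) //= ffunE eqxx eq0 add0r big1 // => l nl.
  by rewrite ffunE mon_inj (negbTE nl) (induced0 Kac_hom) xi_word0.
have /ffunP/(_ k) : model_inj (mon k) w = (0 : {ffun 'I_16 -> W}).
  by rewrite -(gK (model_inj (mon k) w)) -(gK 0) injE (lin_fun0 glin).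
by rewrite !ffunE eqxx.
Qed.

Definition pbw_eval (w : W) (k : pbw) : K := xi_word k.1 (i (word_act k.2 w)).

Lemma kac_act_eval p s T w : kac_act p s = T ->
  unit_act p (xi_word s (i w)) = lc (pbw_eval w) T.
Proof. by move=> <-; apply: (kac_actP Kac_hom). Qed.

Lemma even_actE p (w : W) : ~~ lpar p -> even_act p w = sact (delta_mx p.1 p.2) w.
Proof. by move=> ep; rewrite /even_act mxpart_even_delta -/(lpar p) (negbTE ep). Qed.

Lemma pbw_eval_kill s p w : ~~ lpar p -> sact (delta_mx p.1 p.2) w = 0 ->
  pbw_eval w (s, [:: p]) = 0.
Proof.
by move=> ep e; rewrite /pbw_eval /= even_actE // e (induced0 Kac_hom) xi_word0.
Qed.

Lemma pbw_eval_diag s (mu : 'rV[C]_4) a w : weight_vector mu w ->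
  pbw_eval w (s, [:: (a, a)]) = mu 0 a *: xi_word s (i w).
Proof.
move=> ww; rewrite /pbw_eval /= even_actE ?/lpar ?addbb // (weight_vector_unit a ww).
have [lin _ _] := Kac_hom.
by rewrite (lin_funZ lin) (lin_funZ (xi_word_lin s)).
Qed.

End KacWords.

Lemma lc_pair (C : fieldType) (V : lmodType C) (T : Type) (f : T -> V) k c l :
  lc f ((k, c) :: l) = c%:~R *: f k + lc f l.
Proof. exact: lc_cons. Qed.



Lemma delta_even (C : fieldType) (a b : 'I_4) :
  (delta_mx a b \in gl22_even C) = (odd_idx a == odd_idx b).
Proof.
apply/idP/idP => [/mem_mxspan/(_ a b)|]; last exact: delta_mxspan.
case: eqP => // _ /(_ isT) /eqP; by rewrite mxE !eqxx oner_eq0.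
Qed.

Lemma diag_even (C : fieldType) (d : 'rV[C]_4) : diag_mx d \in gl22_even C.
Proof.
apply/mem_mxspan=> a b; rewrite mxE; case: (a =P b) => [->|_ _]; last by [].
by rewrite eqxx.
Qed.

Lemma sbracket_even (C : fieldType) (X Y : 'M[C]_4) :
  X \in gl22_even C -> Y \in gl22_even C -> sbracket X Y \in gl22_even C.
Proof.
have evenE (Z : 'M[C]_4) : Z \in gl22_even C -> mxpart false Z = Z.
  move=> /mem_mxspan hZ; apply/matrixP=> a b; rewrite mxE.
  case: eqP => // /eqP; rewrite eqbF_neg negbK => ne.
  by rewrite hZ //; move: ne; case: odd_idx; case: odd_idx.
have par (Z : 'M[C]_4) : Z \in gl22_even C -> Z \in gl22_par C.
  move=> /mem_mxspan hZ; apply/mem_mxspan => a b nab; apply: hZ.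
  by move: nab; case: odd_idx; case: odd_idx.
move=> hX hY; rewrite -(evenE X hX) -(evenE Y hY) -mxpart_sbracket ?par //.
exact: mxpart_even.
Qed.

(** Stability under the action need only be tested on matrix units. *)
Lemma sact_closed (C : fieldType) (h : {vspace 'M[C]_4}) (M : smodule h)
  (S : M -> Prop) : unit_spanned h -> S 0 ->
  (forall c x y, S x -> S y -> S (c *: x + y)) ->
  forall X x, X \in h ->
  (forall a b, delta_mx a b \in h -> S (unit_act (a, b) x)) -> S (sact X x).
Proof.
move=> hu S0 Slin X x hX hS; rewrite sact_delta_sum //.
have SD y z : S y -> S z -> S (y + z).
  by move=> Sy Sz; have := Slin 1 y z Sy Sz; rewrite scale1r.
apply: (big_ind S) => // a _; apply: (big_ind S) => // b nz.
by rewrite -[_ *: _]addr0; apply: Slin => //; apply/hS/(hu _ hX).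
Qed.

Definition xi_mul (r s : seq nat) : comb (seq nat) :=
  foldr (fun b l => bindc l (xi_insert b)) [:: (s, 1)] r.

Definition xi_top : seq nat := iota 0 4.

Definition xi_compl (s : seq nat) : seq nat := [seq b <- iota 0 4 | b \notin s].

Lemma xi_mulP (C : numFieldType) (K : smodule (gl22 C)) r s (y : K) :
  xi_word r (xi_word s y) = lc (fun t => xi_word t y) (xi_mul r s).
Proof.
elim: r => [|b r IH] /=; first by rewrite lc_seq1.
rewrite IH (lin_lc _ _ (unit_act_lin (xi_unit b))) lc_bind.
by apply: eq_lc => t; rewrite /= xi_insertP.
Qed.

(** A complementary monomial carries its own monomial to the top one and kills
   all those with a larger number, since these share a factor with it. *)
Lemma xi_mul_compl (k l : 'I_16) :
  let mk := nth [::] xi_monomials k in let ml := nth [::] xi_monomials l in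
  ((k < l)%N -> xi_mul (xi_compl mk) ml = [::]) /\
  (exists e : bool, xi_mul (xi_compl mk) mk = [:: (xi_top, (-1) ^+ e)]).
Proof.
have check : all (fun m => all (fun n =>
     ((m < n)%N ==> nilp (xi_mul (xi_compl (nth [::] xi_monomials m)) (nth [::] xi_monomials n)))
     && has (fun e : bool => xi_mul (xi_compl (nth [::] xi_monomials m)) (nth [::] xi_monomials m)
           == [:: (xi_top, (-1) ^+ e)]) [:: true; false]) (iota 0 16)) (iota 0 16).
  by vm_compute.
have := allP check k; rewrite mem_iota ltn_ord => /(_ isT) /allP /(_ l).
rewrite mem_iota ltn_ord => /(_ isT) /andP[h1 /hasP[e _ /eqP h2]]; split.
  by move=> lt; apply/nilP/(implyP h1).
by exists e.
Qed.

(** On the top monomial the even subalgebra acts through the inducing module,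
   twisted by a character. *)
Lemma kac_act_top p : ~~ lpar p ->
  exists c : int, collect (((xi_top, [:: p]), -1) :: kac_act p xi_top)
    = nseq (c != 0) ((xi_top, [::]), c).
Proof.
have check : all (fun p => lpar p || has (fun c : int =>
     collect (((xi_top, [:: p]), -1) :: kac_act p xi_top)
     == nseq (c != 0) ((xi_top, [::]), c)) [:: 0; 2; -2]) letters.
  by vm_compute.
case/orP: (allP check p (mem_letters p)) => [-> //|/hasP[c _ /eqP h] _].
by exists c.
Qed.

Section KacIrreducible.
Variables (C : numFieldType) (W : smodule (gl22_even C)) (K : smodule (gl22 C)).
Variables (i : W -> K) (mu : 'rV[C]_4).
Hypotheses (hK : is_Kac i) (hW : irreducible_hw upper_order mu W).
Local Notation mon k := (nth [::] xi_monomials (k : 'I_16)).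

Let hi := Kac_hom hK.

Let ilin c v w : i (c *: v + w) = c *: i v + i w.
Proof. by case: hi => lin _ _; apply: lin. Qed.

Let ispart s w : i (spart s w) = spart s (i w).
Proof. by case: hi => _ part _; have := part s w; rewrite addbF. Qed.

(** A non-zero submodule [S] meets the top exterior power, because a suitable
   monomial isolates the first non-zero term of any of its vectors.  The even
   subalgebra acts on the top power through [W], up to a character, so [S]
   contains the top monomial applied to the highest weight vector [w0].  Raising
   by [E14, E24, E13, E23] strips off the four factors one by one, since each
   intermediate vector is of highest weight for one Borel subalgebra of a chain
   of odd reflections; the scalars that appear are the four numbers assumed
   non-zero.  Hence [S] contains [w0], then [W], then everything. *)
Lemma Kac_irreducible :
  mu 0 x1 + mu 0 x4 != 0 -> mu 0 x2 + mu 0 x4 - 1 != 0 ->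
  mu 0 x1 + mu 0 x3 + 1 != 0 -> mu 0 x2 + mu 0 x3 != 0 -> irreducible K.
Proof.
move=> n14 n24 n13 n23; case: (hW) => irrW [w0 [w0nz ww kw]]; case: (irrW) => _ simpleW.
split.
  exists (i w0); apply: contraNneq w0nz => iw0.
  by apply/eqP; apply: (Kac_free hK (s := [::])).
move=> S hS; have [S0 Slin Spart Sact] := hS.
case: (EM (forall x, S x -> x = 0)) => [|nz]; [by left|right].
have {nz} [x Sx xnz] : exists2 x, S x & x != 0.
  apply: contrapT => nex; apply: nz => x Sx; apply: contrapT => /eqP xnz.
  by apply: nex; exists x.
have SZ c y : S y -> S (c *: y).
  by move=> Sy; rewrite -[_ *: _]addr0; apply: Slin.
have SD y z : S y -> S z -> S (y + z).
  by move=> Sy Sz; rewrite -[y]scale1r; apply: Slin.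
have Sxi s y : S y -> S (xi_word s y).
  by move=> Sy; elim: s => //= b s IH; apply: Sact; rewrite ?memvf.
have submod s : ~~ odd (size s) ->
    (forall p w, ~~ lpar p -> S (xi_word s (i w)) -> S (xi_word s (i (even_act p w)))) ->
    submodule (fun w => S (xi_word s (i w))).
  move=> es hs; split=> [|c v w Sv Sw|t w Sw|X w hX Sw].
  - by rewrite (induced0 hi) xi_word0.
  - by rewrite ilin xi_word_lin; apply: Slin.
  - rewrite ispart; have := spart_xi_word s t (i w).
    by rewrite (negbTE es) addbF => <-; apply: Spart.
  apply: (sact_closed (S := fun w => S (xi_word s (i w)))) hX _ => [||c v z Sv Sz|a b hab].
  - exact: unit_spanned_mxspan.
  - by rewrite (induced0 hi) xi_word0.
  - by rewrite ilin xi_word_lin; apply: Slin.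
  have ep : ~~ lpar (a, b) by move: hab; rewrite delta_even /lpar /= => /eqP ->; rewrite addbb.
  have := hs (a, b) w ep Sw; rewrite /even_act mxpart_even_delta.
  by rewrite -/(lpar (a, b)) (negbTE ep).
(* Multiplying by the complement of the smallest monomial of [x] leaves only
   that term, at the top. *)
have [w Stop wnz] : exists2 w, S (xi_word xi_top (i w)) & w != 0.
  have [y xE] := Kac_expand hK x.
  have [k0 k0nz] : exists k, y k != 0.
    apply: contrapT => nk; move/eqP: xnz; apply; rewrite xE big1 // => k _.
    have -> : y k = 0 by apply: contrapT => /eqP yk; apply: nk; exists k.
    by rewrite (induced0 hi) xi_word0.
  case: (@arg_minnP _ k0 (fun k => y k != 0) (fun k => k : nat) k0nz) => k knz kmin.
  exists (y k) => //.
  have [_ [e top]] := xi_mul_compl k k.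
  have := Sxi (xi_compl (mon k)) x Sx; rewrite xE.
  rewrite (lin_fun_sum (xi_word_lin _)) (bigD1 k) //= big1 => [|l nl].
    rewrite addr0 xi_mulP top lc_cons lc_nil addr0 /= => St.
    have := SZ ((-1) ^+ e) _ St; rewrite scalerA rmorphXn /= rmorphN1 -exprD.
    by rewrite -signr_odd oddD addbb scale1r.
  case: (ltngtP l k) => [lt|gt|/val_inj elk].
  - have -> : y l = 0 by apply/eqP; apply: contraLR lt => /kmin; rewrite -leqNgt.
    by rewrite (induced0 hi) !xi_word0.
  - by have [/(_ gt) e0 _] := xi_mul_compl k l; rewrite xi_mulP e0 lc_nil.
  by rewrite elk eqxx in nl.
have {w Stop wnz} Stop : S (xi_word xi_top (i w0)).
  have [|z|all] := simpleW (fun w => S (xi_word xi_top (i w))); last exact: all.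
    apply: submod => // p v ep Sv; have [c tab] := kac_act_top ep.
    set T := unit_act p (xi_word xi_top (i v)).
    have e : lc (fun k => xi_word k.1 (i (word_act k.2 v)))
        (nseq (c != 0) ((xi_top, [::]), c)) = - xi_word xi_top (i (even_act p v)) + T.
      by rewrite -tab lc_collect lc_cons -(kac_actP hi) scaleN1r.
    have -> : xi_word xi_top (i (even_act p v))
        = (-1) *: (- xi_word xi_top (i (even_act p v)) + T) + T.
      by rewrite scaleN1r opprD opprK subrK.
    rewrite -e; apply: Slin; last first.
      by apply: Sact; rewrite ?memvf.
    by case: (c != 0); rewrite ?lc_nil // lc_cons lc_nil addr0; apply: SZ.
  by rewrite (z w Stop) eqxx in wnz.
have down p s t c : c != 0 -> unit_act p (xi_word s (i w0)) = c *: xi_word t (i w0) ->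
    S (xi_word s (i w0)) -> S (xi_word t (i w0)).
  move=> cnz e Ss; rewrite -[xi_word t _]scale1r -(mulVf cnz) -scalerA -e.
  by apply/SZ/Sact; rewrite ?memvf.
have ev34 t : pbw_eval i w0 (t, [:: (x3, x4)]) = 0.
  by apply: pbw_eval_kill => //; apply: kw => //; rewrite delta_even.
have ev12 t : pbw_eval i w0 (t, [:: (x1, x2)]) = 0.
  by apply: pbw_eval_kill => //; apply: kw => //; rewrite delta_even.
have evd t a : pbw_eval i w0 (t, [:: (a, a)]) = mu 0 a *: xi_word t (i w0).
  exact: pbw_eval_diag.
have ev0 t : pbw_eval i w0 (t, [::]) = xi_word t (i w0) by [].
(* The terms ending in [E12] or [E34] vanish on [w0]; the others are scalars. *)
have S013 : S (xi_word [:: 0; 1; 3]%N (i w0)).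
  apply: (down (x1, x4)) n14 _ Stop.
  rewrite (kac_act_eval hK (T := [:: (([:: 1; 2; 3]%N, [:: (x3, x4)]), 1);
    (([:: 0; 1; 3]%N, [:: (x4, x4)]), 1); (([:: 0; 1; 3]%N, [:: (x1, x1)]), 1);
    (([:: 0; 1; 2]%N, [:: (x1, x2)]), -1)])) //.
  rewrite !lc_pair lc_nil ev34 ev12 !evd !scaler0 !scale1r add0r !addr0.
  by rewrite -scalerDl addrC.
have S01 : S (xi_word [:: 0; 1]%N (i w0)).
  apply: (down (x2, x4)) n24 _ S013.
  rewrite (kac_act_eval hK (T := [:: (([:: 0; 1]%N, [:: (x4, x4)]), 1);
    (([:: 0; 1]%N, [:: (x2, x2)]), 1); (([:: 0; 1]%N, [::]), -1);
    (([:: 0; 3]%N, [:: (x3, x4)]), -1)])) //.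
  rewrite !lc_pair lc_nil ev34 !evd ev0 !scaler0 !scale1r !addr0 scaleN1r.
  by rewrite addrA -scalerDl -[X in _ - X]scale1r -scalerBl [_ + mu 0 x2]addrC.
have S1 : S (xi_word [:: 1]%N (i w0)).
  apply: (down (x1, x3)) n13 _ S01.
  rewrite (kac_act_eval hK (T := [:: (([:: 1]%N, [:: (x3, x3)]), 1);
    (([:: 1]%N, [::]), 1); (([:: 1]%N, [:: (x1, x1)]), 1);
    (([:: 0]%N, [:: (x1, x2)]), -1)])) //.
  rewrite !lc_pair lc_nil ev12 !evd ev0 !scaler0 !scale1r !addr0.
  rewrite -[X in _ + (X + _)]scale1r -!scalerDl; congr (_ *: _).
  by rewrite [1 + _]addrC addrCA addrA.
have Sw0 : S (i w0).
  apply: (down (x2, x3) _ [::]) n23 _ S1.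
  rewrite (kac_act_eval hK (T := [:: (([::], [:: (x3, x3)]), 1);
    (([::], [:: (x2, x2)]), 1)])) //.
  by rewrite !lc_pair lc_nil !evd !scale1r !addr0 -scalerDl addrC.
have SW w : S (i w).
  have [|z|all] := simpleW (fun w => S (xi_word [::] (i w))); last exact: all.
    apply: submod => // p v ep Sv.
    rewrite /= -(induced_unit_act hi); first by apply: Sact; rewrite ?memvf.
    by move: ep; rewrite /lpar /is_xi; case: odd_idx; case: odd_idx.
  by rewrite (z w0 Sw0) eqxx in w0nz.
move=> z; have [y ->] := Kac_expand hK z.
by apply: (big_ind S) => // k _; apply: Sxi.
Qed.
End KacIrreducible.

(** * Lowest weight vectors, and the weight of the theorem *)

Section RootString.
Variables (C : numFieldType) (h : {vspace 'M[C]_4}) (M : smodule h).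
Hypothesis (ht : forall d, diag_mx d \in h).
Variables (p q : 'I_4).
Hypotheses (npq : p != q) (par : odd_idx p = odd_idx q).
Hypotheses (hpq : delta_mx p q \in h) (hqp : delta_mx q p \in h).
Implicit Types (v : M) (mu : 'rV[C]_4).
Local Notation f := (unit_act (q, p) : M -> M).

Lemma weight_vector_iter mu v k : weight_vector mu v ->
  weight_vector (mu + k%:R *: (delta_mx 0 q - delta_mx 0 p)) (iter k f v).
Proof.
move=> wv; elim: k => [|k IH]; first by rewrite scale0r addr0.
have -> : k.+1%:R = k%:R + 1 :> C by rewrite -addn1 natrD.
rewrite scalerDl scale1r !addrA /=.
exact: weight_vector_delta.
Qed.

(** The usual computation along a string of weights for the subalgebra [sl(2)]. *)
Lemma raise_lower_iter mu v m k : weight_vector mu v ->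
  mu 0 p - mu 0 q = m%:R -> sact (delta_mx p q) v = 0 ->
  sact (delta_mx p q) (iter k.+1 f v)
  = (k.+1%:R * (m%:R - k%:R)) *: iter k f v.
Proof.
move=> wv hm ev.
have comm x : sact (delta_mx p q) (f x) = f (sact (delta_mx p q) x)
    + (sact (delta_mx p p) x - sact (delta_mx q q) x).
  have := sact_bracket x hpq hqp (mxpart_delta C p q) (mxpart_delta C q p).
  rewrite sbracket_delta par addbb expr0 !scale1r !eqxx !mulr1n.
  have hd a : delta_mx a a \in h by rewrite delta_diag.
  have -> : sact (delta_mx p p - delta_mx q q) x
      = sact (delta_mx p p) x - sact (delta_mx q q) x.
    have := sact_linearl (hd q) (hd p) (-1) x; rewrite !scaleN1r.
    by rewrite [- delta_mx q q + _]addrC => ->; rewrite addrC.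
  by move=> ->; rewrite addrC subrK.
have fZ c x : f (c *: x) = c *: f x by exact: sactrZ.
have step j : sact (delta_mx p p) (iter j f v) - sact (delta_mx q q) (iter j f v)
    = (m%:R - j%:R *+ 2) *: iter j f v.
  rewrite !(weight_vector_unit _ (weight_vector_iter j wv)) -scalerBl.
  congr (_ *: _); rewrite !mxE !eqxx (negbTE npq) eq_sym (negbTE npq) /= -hm.
  by ring.
elim: k => [|k IH].
  rewrite [LHS]comm ev [f 0]sactr0 // add0r (step 0%N) /=; congr (_ *: _); ring.
rewrite [iter k.+2 _ _]iterS comm IH fZ -iterS step -scalerDl; congr (_ *: _).
ring.
Qed.

Lemma lower_iter_neq0 mu v m k : v != 0 -> weight_vector mu v ->
  mu 0 p - mu 0 q = m%:R -> sact (delta_mx p q) v = 0 -> (k <= m)%N ->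
  iter k f v != 0.
Proof.
move=> vnz wv hm ev; elim: k => // k IH lt.
apply/eqP => z; have := raise_lower_iter k wv hm ev; rewrite z sactr0 //.
move/esym/eqP; rewrite scaler_eq0 (negbTE (IH (ltnW lt))) orbF mulf_eq0.
by rewrite pnatr_eq0 subr_eq0 eqr_nat (gtn_eqF lt).
Qed.

Lemma raise_lower_top mu v m : weight_vector mu v ->
  mu 0 p - mu 0 q = m%:R -> sact (delta_mx p q) v = 0 ->
  sact (delta_mx p q) (iter m.+1 f v) = 0.
Proof.
by move=> wv hm ev; rewrite (raise_lower_iter m wv hm ev) subrr mulr0 scale0r.
Qed.

Lemma sact_iter_comm X v k : (forall x, sact X (f x) = f (sact X x)) ->
  sact X (iter k f v) = iter k f (sact X v).
Proof. by move=> comm; elim: k => //= k <-. Qed.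

End RootString.

Section LowestWeight.
Variables (C : numFieldType) (W : smodule (gl22_even C)) (mu : 'rV[C]_4).
Variables (m n : nat).
Hypotheses (hW : irreducible_hw upper_order mu W).
Hypotheses (hm : mu 0 x1 - mu 0 x2 = m%:R) (hn : mu 0 x3 - mu 0 x4 = n%:R).

Let ht (d : 'rV[C]_4) : diag_mx d \in gl22_even C := diag_even d.
Let hu : unit_spanned (gl22_even C) := @unit_spanned_mxspan _ _.

Lemma mem_upper_order a : a \in upper_order.
Proof. by case: a => [[|[|[|[|?]]]] ?]. Qed.

Lemma even_unit_comm a b c d (x : W) : odd_idx a = odd_idx b ->
  odd_idx c = odd_idx d -> odd_idx a != odd_idx c ->
  sact (delta_mx a b) (sact (delta_mx c d) x) = sact (delta_mx c d) (sact (delta_mx a b) x).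
Proof.
move=> ab cd ac.
have hab : delta_mx a b \in gl22_even C by rewrite delta_even ab.
have hcd : delta_mx c d \in gl22_even C by rewrite delta_even cd.
have := sact_bracket x hab hcd (mxpart_delta C a b) (mxpart_delta C c d).
rewrite sbracket_delta ab addbb expr0 !scale1r.
have -> : (b == c) = false by apply: contraNF ac => /eqP <-; rewrite ab.
have -> : (d == a) = false by apply: contraNF ac => /eqP <-; rewrite cd.
by rewrite !mulr0n subr0 sactl0 => /esym/eqP; rewrite subr_eq0 => /eqP.
Qed.

Lemma even_raising (z : W) : sact (delta_mx x1 x2) z = 0 ->
  sact (delta_mx x3 x4) z = 0 ->
  forall a b, (index a upper_order < index b upper_order)%N ->
  delta_mx a b \in gl22_even C -> sact (delta_mx a b) z = 0.
Proof.
move=> z12 z34 a b; rewrite delta_even.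
by case: a b => [[|[|[|[|?]]]] ?] [[|[|[|[|?]]]] ?].
Qed.

Lemma height_upper (nu : 'rV[C]_4) :
  height_of upper_order nu = - nu 0 x2 - nu 0 x3 *+ 2 - nu 0 x4 *+ 3.
Proof.
rewrite /height_of !big_ord_recl big_ord0.
rewrite (_ : lift ord0 ord0 = x2); last exact: val_inj.
rewrite (_ : lift ord0 (lift ord0 ord0) = x3); last exact: val_inj.
rewrite (_ : lift ord0 (lift ord0 (lift ord0 ord0)) = x4); last exact: val_inj.
rewrite /=; ring.
Qed.

(** Lowering the highest weight vector one step beyond [m] gives a vector killed
   by all raising elements, of a strictly lower weight; in an irreducible module
   it is zero.  So the strings through [E21] and [E43] stop at [m] and [n],
   and up to there they do not vanish. *)
Lemma lowest_weight_vector : exists w : W,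
  [/\ w != 0,
      weight_vector (mu + m%:R *: (delta_mx 0 x2 - delta_mx 0 x1)
                        + n%:R *: (delta_mx 0 x4 - delta_mx 0 x3)) w,
      sact (delta_mx x2 x1) w = 0 & sact (delta_mx x4 x3) w = 0].
Proof.
case: hW => irrW [v hv]; case: (hv) => vnz wv kv.
have e12 : sact (delta_mx x1 x2) v = 0 by apply: kv; rewrite ?delta_even.
have e34 : sact (delta_mx x3 x4) v = 0 by apply: kv; rewrite ?delta_even.
pose f := unit_act (x2, x1) : W -> W; pose g := unit_act (x4, x3) : W -> W.
have h21 : delta_mx x2 x1 \in gl22_even C by rewrite delta_even.
have h43 : delta_mx x4 x3 \in gl22_even C by rewrite delta_even.
have h12 : delta_mx x1 x2 \in gl22_even C by rewrite delta_even.
have h34 : delta_mx x3 x4 \in gl22_even C by rewrite delta_even.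
have fg k x : f (iter k g x) = iter k g (f x).
  by apply: sact_iter_comm => y; apply: even_unit_comm.
have fg' k j x : iter j f (iter k g x) = iter k g (iter j f x).
  by elim: j => //= j ->; apply: fg.
have f0 : iter m.+1 f v = 0.
  apply: (no_lower_highest_weight ht hu (@sbracket_even C) mem_upper_order (n := m) irrW hv
    (weight_vector_iter ht h21 m.+1 wv)).
    rewrite !height_upper !mxE /= -[m.+1]addn1 natrD; ring.
  apply: even_raising; first exact: raise_lower_top e12.
  by rewrite sact_iter_comm ?e34 => [|x];
    [elim: (m.+1) => //= k ->; apply: sactr0|apply: even_unit_comm].
have g0 : iter n.+1 g v = 0.
  apply: (no_lower_highest_weight ht hu (@sbracket_even C) mem_upper_order (n := n) irrW hv
    (weight_vector_iter ht h43 n.+1 wv)).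
    rewrite !height_upper !mxE /= -[n.+1]addn1 natrD; ring.
  apply: even_raising; last exact: raise_lower_top e34.
  by rewrite sact_iter_comm ?e12 => [|x];
    [elim: (n.+1) => //= k ->; apply: sactr0|apply: even_unit_comm].
pose u := iter m f v.
have wu := weight_vector_iter ht h21 m wv.
have unz : u != 0 by apply: (lower_iter_neq0 ht _ _ h12 h21 vnz wv hm e12).
have u34 : sact (delta_mx x3 x4) u = 0.
  by rewrite sact_iter_comm ?e34 => [|x];
    [elim: (m) => //= k ->; apply: sactr0|apply: even_unit_comm].
exists (iter n g u); split.
- apply: (lower_iter_neq0 ht _ _ h34 h43 unz wu _ u34 (m := n)) => //.
  by rewrite -hn !mxE /=; ring.
- exact: weight_vector_iter.
- rewrite -[LHS]/(f (iter n g u)) fg -[f u]/(iter m.+1 f v) f0.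
  by elim: (n) => //= k ->; apply: sactr0.
rewrite -[LHS]/(iter n.+1 g u) -fg' g0.
by elim: (m) => //= k ->; apply: sactr0.
Qed.

End LowestWeight.

Lemma mem_natural_order a : a \in natural_order.
Proof. by case: a => [[|[|[|[|?]]]] ?]. Qed.

Section Main.
Variables (C : numFieldType) (a b : nat).
Hypotheses (ha : (0 < a)%N) (hab : b <> (a - 1)%N).
Variables (W : smodule (gl22_even C)) (K : smodule (gl22 C)) (i : W -> K).
Hypotheses (hW : irreducible_hw upper_order (breve_weight C a b) W) (hK : is_Kac i).

Let mu := breve_weight C a b.

Lemma breve_weightE :
  [/\ mu 0 x1 = a%:R, mu 0 x2 = 2 - a%:R, mu 0 x3 = b%:R - 1
    & mu 0 x4 = - b%:R - 1].
Proof. by split; rewrite !mxE /= !mulr0 !mulr1 ?addr0 ?add0r // addrC. Qed.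

(** The four scalars of typicality are, up to sign, [a + b] twice and
   [a - b - 1] twice. *)
Lemma Kac_breve_irreducible : irreducible K.
Proof.
have [m1 m2 m3 m4] := breve_weightE.
have nab : a%:R - b%:R - 1 != 0 :> C.
  rewrite -addrA -opprD subr_eq0 -[1]/(1%:R) -natrD eqr_nat addn1.
  by apply/eqP => e; apply: hab; rewrite e subn1.
have pab : a%:R + b%:R != 0 :> C by rewrite -natrD pnatr_eq0 addn_eq0 negb_and -lt0n ha.
apply: (Kac_irreducible hK hW); rewrite -/mu ?m1 ?m2 ?m3 ?m4.
- by rewrite addrA.
- rewrite -oppr_eq0; move: pab; congr (_ != _); ring.
- move: pab; congr (_ != _); ring.
- rewrite -oppr_eq0; move: nab; congr (_ != _); ring.
Qed.

Lemma induced_weight (nu : 'rV[C]_4) (w : W) : weight_vector nu w -> weight_vector nu (i w).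
Proof.
move=> ww d; have [lin _ act] := Kac_hom hK.
have hd : diag_mx d \in gl22_par C.
  by apply/mem_mxspan => k l; rewrite mxE; case: (k =P l) => // ->; case: odd_idx.
rewrite -act // [sact _ _](_ : _ = sact (mxpart false (diag_mx d)) w) // mxpart_diag.
by rewrite ww (lin_funZ lin).
Qed.

Let ht (d : 'rV[C]_4) : diag_mx d \in gl22 C := memvf _.

(** From the lowest weight vector [w] of [W], which is of highest weight for the
   order [x2, x1, x4, x3], the odd reflections that move [x1] past [x4] and past
   [x3] lead to the order of the theorem and to the vector [E31 E41 w]. *)
Lemma Kac_breve_natural : exists u : K, highest_weight_vector natural_order
  (a%:R *: (epsm C - epsp C) + b%:R *: (delm C - delp C)) u.
Proof.
have [m1 m2 m3 m4] := breve_weightE.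
have [||w [wnz ww w21 w43]] := @lowest_weight_vector C W mu (2 * (a - 1)) (2 * b) hW.
- by rewrite m1 m2 natrM natrB //; ring.
- by rewrite m3 m4 natrM; ring.
exists (xi_word [:: 0; 2]%N (i w)); split.
- by apply: contraNneq wnz => /(Kac_free hK) ->.
- have := weight_vector_delta ht (memvf (delta_mx x3 x1)) (weight_vector_delta ht
    (memvf (delta_mx x4 x1)) (induced_weight ww)).
  set nu := (X in weight_vector X) => wnu.
  suff -> : a%:R *: (epsm C - epsp C) + b%:R *: (delm C - delp C) = nu by [].
  apply/rowP => -[[|[|[|[|?]]]] ?] //; rewrite /nu natrM natrB // natrM !mxE /=; ring.
have ev21 t : pbw_eval i w (t, [:: (x2, x1)]) = 0 by apply: pbw_eval_kill.
have ev43 t : pbw_eval i w (t, [:: (x4, x3)]) = 0 by apply: pbw_eval_kill.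
move=> k l lt _; rewrite -[LHS]/(unit_act (k, l) (xi_word [:: 0; 2]%N (i w))).
rewrite (kac_act_eval hK _ (erefl _)) /lc big1_seq // => t /andP[_].
(* Every term produced by a raising unit ends in [E21] or [E43], which kill [w]. *)
have check : all (fun p : letter =>
    (index p.1 natural_order < index p.2 natural_order)%N ==>
    all (fun t => t.1.2 \in [:: [:: (x2, x1)]; [:: (x4, x3)]]) (kac_act p [:: 0; 2]%N)) letters.
  by vm_compute.
move=> /(allP (implyP (allP check (k, l) (mem_letters _)) lt)).
case: t => -[t u] c; rewrite /= !inE => /orP[] /eqP ->.
  by rewrite ev21 scaler0.
by rewrite ev43 scaler0.
Qed.

Lemma Kac_breve_is_V : is_V a b K.
Proof. by split; [apply: Kac_breve_irreducible|apply: Kac_breve_natural]. Qed.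

(** The diagonal matrices act by the weight of [v] corrected by those of the two
   lowering factors, which is zero.  The lowering units of [kk] repeat a factor,
   and the raising ones produce [E11 + E33] or [E22 + E44], which vanish on the
   weight of [v]. *)
Lemma Kac_breve_spherical (v : W) : v != 0 ->
  weight_vector (epsp C + epsm C - delp C - delm C) v ->
  k_spherical (sact (xi11 C) (sact (xi22 C) (i v))).
Proof.
move=> vnz wv; set w := sact _ _.
have wE : w = xi_word [:: 0; 3]%N (i v) by [].
split; first by rewrite wE; apply: contraNneq vnz => /(Kac_free hK) ->.
have w0 : weight_vector 0 w.
  have := weight_vector_delta ht (memvf (delta_mx x3 x1)) (weight_vector_delta ht
    (memvf (delta_mx x4 x2)) (induced_weight wv)).
  set nu := (X in weight_vector X) => wnu.
  suff -> : 0 = nu by [].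
  by apply/rowP => -[[|[|[|[|?]]]] ?] //; rewrite !mxE /=; ring.
have evd t c : pbw_eval i v (t, [:: (c, c)])
    = (if odd_idx c then -1 else 1) *: xi_word t (i v).
  rewrite (pbw_eval_diag hK t c wv); congr (_ *: _).
  by case: c => [[|[|[|[|?]]]] ?] //; rewrite !mxE /=; ring.
have k13 : unit_act (x1, x3) w = 0.
  rewrite wE (kac_act_eval hK (T := [:: (([:: 3]%N, [:: (x3, x3)]), 1);
    (([:: 3]%N, [:: (x1, x1)]), 1)])) //.
  by rewrite !lc_pair lc_nil !evd !scale1r addr0 scaleN1r addNr.
have k24 : unit_act (x2, x4) w = 0.
  rewrite wE (kac_act_eval hK (T := [:: (([:: 0]%N, [:: (x2, x2)]), -1);
    (([:: 0]%N, [:: (x4, x4)]), -1)])) //.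
  by rewrite !lc_pair lc_nil !evd !scale1r addr0 -scalerDr !scaleN1r subrr oppr0.
have k31 : unit_act (x3, x1) w = 0.
  by rewrite wE (kac_act_eval hK (T := [::])) // lc_nil.
have k42 : unit_act (x4, x2) w = 0.
  by rewrite wE (kac_act_eval hK (T := [::])) // lc_nil.
move=> X hX; rewrite (sact_delta_sum w (@unit_spanned_gl22 C) (memvf X)).
apply: big1 => c _; apply: big1 => d nz.
suff -> : sact (delta_mx c d) w = 0 by rewrite scaler0.
have /orP[/eqP <-|] : (c == d) || ((c, d) \in [:: (x1, x3); (x3, x1); (x2, x4); (x4, x2)]).
  move/mem_mxspan: hX => /(_ c d) hcd; apply: contraNT nz => ncd.
  by rewrite hcd.
  by rewrite (weight_vector_unit c w0) mxE scale0r.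
by rewrite !inE => /or4P[] /eqP[-> ->].
Qed.

End Main.

Theorem theorem4p11 (R : realType) (a b : nat)
  (ha : (0 < a)%N) (hla : hook11 (a :: nseq b 1%N)) (hab : b <> (a - 1)%N)
  (W : smodule (gl22_even R[i]))
  (hW : irreducible_hw upper_order (breve_weight R[i] a b) W)
  (K : smodule (gl22 R[i])) (i : W -> K) (hK : is_Kac i)
  (v : W) (hv0 : v != 0)
  (hv : weight_vector (epsp R[i] + epsm R[i] - delp R[i] - delm R[i]) v) :
  [/\ is_V a b K,
      forall V : smodule (gl22 R[i]), is_V a b V -> smod_isom K V
    & k_spherical (sact (xi11 R[i]) (sact (xi22 R[i]) (i v)))].
Proof.
have KV := Kac_breve_is_V ha hab hW hK.
split=> // [V VV|]; last exact: Kac_breve_spherical hK _ hv0 hv.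
apply: (irreducible_hw_isom _ _ _ mem_natural_order KV VV).
- by move=> d; apply: memvf.
- exact: unit_spanned_gl22.
- by move=> X Y _ _; apply: memvf.
Qed.
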